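(* Let $\mathbb{K}\in\{\mathbb{R},\mathbb{C}\}$, let $d\ge 1$, and fix a norm $\|\cdot\|$ on $\mathbb{K}^{d}$. Let $\mathscr{A}\subset\mathbb{K}^{d\times d}$ be a nonempty compact irreducible set of matrices and let $\mathscr{B}\subset\mathbb{K}^{d\times d}$ be a nonempty bounded set of matrices. Then for each integer $p\ge d-1$, \[ \left|\rho(\mathscr{A})-\rho(\mathscr{B})\right|\le \nu_{p}(\mathscr{A})\, H(\mathscr{A},\mathscr{B}), \qquad\text{where}\qquad \nu_{p}(\mathscr{A})=\frac{\max\{1,\|\mathscr{A}\|^{p}\}}{\chi_{p}(\mathscr{A})}. \] Here $\chi_p(\mathscr{A})>0$, so $\nu_p(\mathscr{A})$ is a finite constant.
   Context: Norms. For a matrix $A\in\mathbb{K}^{d\times d}$, $\|A\|$ is the operator norm induced by the fixed norm $\|\cdot\|$ on $\mathbb{K}^d$. For a bounded set $\mathscr{A}$ of matrices, $\|\mathscr{A}\|=\sup_{A\in\mathscr{A}}\|A\|$. Products. For $n\ge1$, $\mathscr{A}^{n}$ is the set of all products of $n$ matrices from $\mathscr{A}$ (repetitions allowed), and $\mathscr{A}^{0}=\{I\}$. Joint spectral radius. For a nonempty bounded set $\mathscr{A}\subset\mathbb{K}^{d\times d}$, $\rho(\mathscr{A})=\limsup_{n\to\infty}\|\mathscr{A}^{n}\|^{1/n}$, where $\|\mathscr{A}^{n}\|=\sup_{A\in\mathscr{A}^{n}}\|A\|$. This is finite and does not depend on the choice of the norm. Hausdorff metric. $H(\mathscr{A},\mathscr{B})=\max\left\{\sup_{A\in\mathscr{A}}\inf_{B\in\mathscr{B}}\|A-B\|,\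 \sup_{B\in\mathscr{B}}\inf_{A\in\mathscr{A}}\|A-B\|\right\}$. Irreducibility. A set $\mathscr{A}\subset\mathbb{K}^{d\times d}$ is irreducible if the matrices in $\mathscr{A}$ have no common invariant $\mathbb{K}$-linear subspace of $\mathbb{K}^d$ other than $\{0\}$ and $\mathbb{K}^d$. Measure of irreducibility. For an integer $p\ge 0$ let $\mathscr{A}_{p}=\bigcup_{k=0}^{p}\mathscr{A}^{k}$, and for $x\in\mathbb{K}^d$ let $\mathscr{A}_{p}(x)=\{Ax: A\in\mathscr{A}_{p}\}$. Let $\mathbb{S}(t)=\{y\in\mathbb{K}^d:\|y\|\le t\}$ be the ball of radius $t$, and let $\mathrm{conv}$ denote the convex hull. The $p$-measure of irreducibility of $\mathscr{A}$ with respect to $\|\cdot\|$ is \[ \chi_{p}(\mathscr{A})=\inf_{x\in\mathbb{K}^{d},\ \|x\|=1}\ \sup\{t:\ \mathbb{S}(t)\subseteq \mathrm{conv}(\mathscr{A}_{p}(x)\cup\mathscr{A}_{p}(-x))\}. \]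
   Formalization: Over the complex numbers χ_p(A)>0 can fail (d=1, p=0, A={1}), so there the inequality is stated when χ_p(A)>0; positivity and the bound are also proved unconditionally for χ_p symmetrized by all unit-modulus scalars. *)

(* Defs.v *)
From HB Require Import structures.
From mathcomp Require Import all_boot all_order all_algebra.
From mathcomp Require Import all_classical all_reals all_analysis.
From mathcomp Require Import complex.

Set Implicit Arguments.
Unset Strict Implicit.
Unset Printing Implicit Defensive.

Import Order.TTheory GRing.Theory Num.Theory.
Import numFieldNormedType.Exports.

Local Open Scope classical_set_scope.
Local Open Scope ring_scope.

Variant base_field := RealScalars | ComplexScalars.

Definition scalars (R : realType) (F : base_field) : numFieldType :=
  match F with
  | RealScalars => R
  | ComplexScalars => R[i]
  end.

(* The norm of a numFieldType takes values in the field itself; this is the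
   absolute value seen as an element of R. *)
Definition modulus (R : realType) (F : base_field) : scalars R F -> R :=
  match F return scalars R F -> R with
  | RealScalars => fun x : R => `|x|
  | ComplexScalars => fun z : R[i] => complex.Re `|z|
  end.

(* Nonnegativity of N follows from the three conditions. *)
Record is_norm (R : realType) (F : base_field) (d : nat)
    (N : 'cV[scalars R F]_d -> R) : Prop := IsNorm {
  is_norm_definite : forall x, N x = 0 -> x = 0;
  is_norm_scale : forall a x, N (a *: x) = modulus a * N x;
  is_norm_triangle : forall x y, N (x + y) <= N x + N y }.

Section Notions.
Variables (R : realType) (K : numFieldType) (d : nat).
Implicit Types (N : 'cV[K]_d -> R) (A B : set 'M[K]_d) (S : set 'cV[K]_d).

(* All suprema and infima below are taken in R. For d >= 1, a norm N and
   nonempty bounded sets of matrices, the sets of reals involved are nonempty and bounded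
   on the relevant side, so the default values of sup and inf play no role. *)

Definition opnorm N (M : 'M[K]_d) : R :=
  sup [set N (M *m x) | x in [set x | N x = 1]].

Definition set_norm N A : R := sup [set opnorm N M | M in A].

Fixpoint set_pow A (n : nat) : set 'M[K]_d :=
  if n is m.+1 then [set M *m P | M in A & P in set_pow A m]
  else [set 1%:M].

(* The term at n = 0 is a default value and does not affect the limsup. *)
Definition joint_spectral_radius N A : R :=
  limn_sup (fun n => set_norm N (set_pow A n) `^ n%:R^-1).

Definition hausdorff_distance N A B : R :=
  Num.max (sup [set inf [set opnorm N (M - P) | P in B] | M in A])
          (sup [set inf [set opnorm N (M - P) | M in A] | P in B]).

Definition irreducible_set A : Prop :=
  forall U : {vspace 'cV[K]_d},
    (forall M, A M -> forall x, x \in U -> M *m x \in U) ->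
    U = 0%VS \/ U = fullv.

(* The library's convex_set uses weights t in K with 0 <= t <= 1. In the order
   of R[i] this forces t to be real, so for complex scalars too this is the
   usual convex hull of a real vector space. *)
Definition convex_hull S : set 'cV[K]_d :=
  smallest (@convex_set K 'cV[K]_d) S.

Definition orbit_upto A (p : nat) (x : 'cV[K]_d) : set 'cV[K]_d :=
  [set M *m x | M in \bigcup_(k < p.+1) set_pow A k].

Definition norm_ball N (t : R) : set 'cV[K]_d := [set y | N y <= t].

Definition inner_radius N S : R :=
  sup [set t : R | norm_ball N t `<=` convex_hull S].

Definition irreducibility_measure N (p : nat) A : R :=
  inf [set inner_radius N (orbit_upto A p x `|` orbit_upto A p (- x))
      | x in [set x | N x = 1]].

Definition lipschitz_const N (p : nat) A : R :=
  Num.max 1 (set_norm N A ^+ p) / irreducibility_measure N p A.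

(* Over R[i] the measure above can vanish for an irreducible set: for d = 1 and
   p = 0 the hull is the segment [-x, x], which contains no disc, and for a set
   of real matrices the hull at a real x lies in R^d. The usual variant for
   complex scalars symmetrizes by all scalars of modulus 1 instead of {1, -1};
   over R the two coincide. *)
Definition circled_irreducibility_measure N (p : nat) A : R :=
  inf [set inner_radius N
             (\bigcup_(a in [set a : K | `|a| = 1]) orbit_upto A p (a *: x))
      | x in [set x | N x = 1]].

Definition circled_lipschitz_const N (p : nat) A : R :=
  Num.max 1 (set_norm N A ^+ p) / circled_irreducibility_measure N p A.

End Notions.

(* Main.v *)
Require Import Defs.
From HB Require Import structures.
From mathcomp Require Import all_boot all_order all_algebra.
From mathcomp Require Import all_classical all_reals all_analysis.
From mathcomp Require Import complex.
From mathcomp Require Import ring lra.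

Set Implicit Arguments.
Unset Strict Implicit.
Unset Printing Implicit Defensive.

Import Order.TTheory GRing.Theory Num.Theory.
Import numFieldNormedType.Exports.

Local Open Scope classical_set_scope.
Local Open Scope ring_scope.

(** Write rho for the joint spectral radius, H for the Hausdorff distance and c
for the measure of irreducibility.  The estimate follows from one property of
c, [dominates]: if a seminorm w satisfies w (M x) <= r * w x for every M in A,
then the seminorm ball of radius max (1, r ^ p) * w x contains the orbit of x
up to length p, hence its convex hull, hence the N-ball of radius c * N x.  So
the values of w at any two vectors of N-norm 1 differ at most by the factor
max (1, r ^ p) / c: the eccentricity of every such seminorm relative to N is
bounded independently of w ([inner_radius_dominates]).

Such seminorms come from the products themselves.  For m : nat let v_m x be the
supremum of N (P x) / r ^ k over the products P of k >= m factors of A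
([tail_sup]).  Peeling off the rightmost factor gives
sup_(M in A) v_m (M x) = r * v_(m+1) x, hence v_m (M x) <= r * v_m x.

Upper bound.  Take r > rho A, so that v_0 is finite and lies between N and a
multiple of N.  A matrix P of B differs from a matrix of A by at most h, where
h > H, so the bound on the eccentricity gives
v_0 (P x) <= (r + h * max (1, r ^ p) / c) * v_0 x.  Hence rho B is at most that
factor; let r tend to rho A ([jsr_upper]).

Lower bound.  Applied to r > rho A, the bound on the eccentricity also shows
that the products of n factors of A are bounded by a constant times r ^ n, with
a constant that stays bounded as r tends to rho A, so r = rho A is allowed
([growth_jsr]).  Let L be the infimum of the constants l such that v_m <= l * N
for some m.  It is at least 1, because products of length m cannot all contract
by a factor smaller than rho A ^ m ([jsr_no_contraction]).  For large m the
seminorms v_m are bounded by almost L * N, while the bound on the eccentricity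
applied to v_(m+1) bounds L * N by a multiple of v_(m+1).  This compares
v_m with v_(m+1), and for every x some P in B satisfies
v_m (P x) >= lam * v_(m+1) x, with lam close to rho A - H * max (1, rho ^ p) / c.
Iterating from level m + n down to level m yields products of n factors of B of
size at least lam ^ n up to a constant ([jsr_lower_of_growth]).  Comparing two
consecutive levels in this way replaces the construction of a Barabanov norm.

Positivity of the measure.  For x <> 0 irreducibility provides d products of at
most d - 1 factors whose values at x form a basis
([irreducible_free_orbit]).  Unit combinations of that basis cover a ball whose
radius can be kept in a neighbourhood of x, and the unit sphere is compact
([uniform_frame]).  Over the reals the only scalars of modulus 1 are 1 and -1,
so the two measures coincide there. *)

(** * The scalar field and its real subfield *)

Section Scalars.
Variables (R : realType) (F : base_field).
Local Notation K := (scalars R F).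

Definition real_scalar : R -> K :=
  match F return R -> scalars R F with
  | RealScalars => id
  | ComplexScalars => fun x => x%:C%C
  end.

Lemma normr_scalarE (a : K) : `|a| = real_scalar (modulus a).
Proof. by rewrite /modulus /real_scalar; case: F a => //= a; rewrite normcE. Qed.

Lemma real_scalar_le x y : (real_scalar x <= real_scalar y) = (x <= y).
Proof. by rewrite /real_scalar; case: F => //=; rewrite lecR. Qed.

Lemma real_scalarD x y : real_scalar (x + y) = real_scalar x + real_scalar y.
Proof. by rewrite /real_scalar; case: F => //=; rewrite rmorphD. Qed.

Lemma real_scalarM x y : real_scalar (x * y) = real_scalar x * real_scalar y.
Proof. by rewrite /real_scalar; case: F => //=; rewrite rmorphM. Qed.

Lemma real_scalar0 : real_scalar 0 = 0.
Proof. by rewrite /real_scalar; case: F. Qed.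

Lemma real_scalar1 : real_scalar 1 = 1.
Proof. by rewrite /real_scalar; case: F. Qed.

Lemma real_scalar_inj : injective real_scalar.
Proof.
by move=> x y xy; apply/eqP; rewrite eq_le -!real_scalar_le xy lexx.
Qed.

Lemma modulus_real_scalar x : modulus (real_scalar x) = `|x|.
Proof.
rewrite /modulus /real_scalar; case: F => //=.
by rewrite expr0n addr0 sqrtr_sqr.
Qed.

Lemma modulus_ge0 (a : K) : 0 <= modulus a.
Proof. by rewrite -real_scalar_le real_scalar0 -normr_scalarE. Qed.

Lemma modulusM (a b : K) : modulus (a * b) = modulus a * modulus b.
Proof.
by apply: real_scalar_inj; rewrite real_scalarM -!normr_scalarE normrM.
Qed.

Lemma modulusD (a b : K) : modulus (a + b) <= modulus a + modulus b.
Proof.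
by rewrite -real_scalar_le real_scalarD -!normr_scalarE ler_normD.
Qed.

Lemma modulus0 : modulus (0 : K) = 0.
Proof. by rewrite -real_scalar0 modulus_real_scalar normr0. Qed.

Lemma modulus1 : modulus (1 : K) = 1.
Proof. by rewrite -real_scalar1 modulus_real_scalar normr1. Qed.

Lemma modulusN (a : K) : modulus (- a) = modulus a.
Proof. by apply: real_scalar_inj; rewrite -!normr_scalarE normrN. Qed.

Lemma modulus_eq0 (a : K) : (modulus a = 0) -> a = 0.
Proof. by move=> a0; apply/eqP; rewrite -normr_eq0 normr_scalarE a0 real_scalar0. Qed.

Lemma ge0_real_scalar (a : K) : 0 <= a -> real_scalar (modulus a) = a.
Proof. by move=> a0; rewrite -normr_scalarE ger0_norm. Qed.

(** The scalar field is spanned over the reals by 1 and one more scalar j (0 over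
R itself), with coordinates controlled by the modulus.  This allows compactness
arguments to be carried out in a real coordinate space for both fields. *)
Lemma real_coordinates : exists2 j : K, modulus j <= 1 &
  forall z : K, exists a b, [/\ z = real_scalar a + real_scalar b * j,
    `|a| <= modulus z & `|b| <= modulus z].
Proof.
rewrite /modulus /real_scalar; case: F => /=.
  exists 0 => [|z]; first by rewrite normr0.
  by exists z, 0; rewrite mulr0 addr0 normr0.
have normi : `|'i%C| = 1 :> R[i].
  by rewrite normc_def /= expr0n add0r expr1n sqrtr1.
exists 'i%C => [|z]; first by rewrite -[Normc.normc _]/(complex.Re `|'i%C|) normi.
exists (complex.Re z), (complex.Im z).
have reE : `|z| = (complex.Re `|z|)%:C%C by rewrite normc_def.
split.
- by rewrite {1}[z]complexE mulrC.
- by have := normc_ge_Re z; rewrite reE lecR.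
- have := normc_ge_Re (- (z * 'i%C)).
  rewrite normrN normrM normi mulr1 reE lecR.
  by case: z {reE} => x y /=; rewrite mulr0 mulr1 sub0r opprK.
Qed.

End Scalars.

(** * Seminorms and the compactness of spheres *)

Record is_seminorm (R : realType) (F : base_field) (d : nat)
    (w : 'cV[scalars R F]_d -> R) : Prop := IsSeminorm {
  seminormZ : forall a x, w (a *: x) = modulus a * w x;
  seminormD : forall x y, w (x + y) <= w x + w y }.

Lemma norm_seminorm (R : realType) (F : base_field) (d : nat)
  (N : 'cV[scalars R F]_d -> R) : is_norm N -> is_seminorm N.
Proof. by case. Qed.

Section Seminorms.
Variables (R : realType) (F : base_field) (d : nat).
Local Notation K := (scalars R F).
Variables (w : 'cV[K]_d -> R) (hw : is_seminorm w).

Lemma seminorm0 : w 0 = 0.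
Proof. by have := seminormZ hw 0 0; rewrite scale0r modulus0 mul0r. Qed.

Lemma seminormN x : w (- x) = w x.
Proof. by rewrite -scaleN1r (seminormZ hw) modulusN modulus1 mul1r. Qed.

Lemma seminorm_ge0 x : 0 <= w x.
Proof.
have := seminormD hw x (- x); rewrite subrr seminorm0 seminormN.
by rewrite -mulr2n pmulrn_lge0.
Qed.

Lemma seminormZr t x : w (real_scalar F t *: x) = `|t| * w x.
Proof. by rewrite (seminormZ hw) modulus_real_scalar. Qed.

Lemma seminorm_leB x y : w y <= w x + w (x - y).
Proof.
rewrite -(seminormN (x - y)) opprB (le_trans _ (seminormD hw _ _)) //.
by rewrite addrCA subrr addr0.
Qed.

Lemma seminorm_sum (I : finType) (f : I -> 'cV[K]_d) :
  w (\sum_i f i) <= \sum_i w (f i).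
Proof.
elim/big_ind2: _ => [|x1 x2 y1 y2 le1 le2|//]; first by rewrite seminorm0.
exact: le_trans (seminormD hw _ _) (lerD le1 le2).
Qed.

End Seminorms.

Definition l1_norm (R : realType) (F : base_field) (d : nat)
  (x : 'cV[scalars R F]_d) : R := \sum_i modulus (x i 0).

Section FiniteDimension.
Variables (R : realType) (F : base_field) (d : nat).
Local Notation K := (scalars R F).
Local Notation l1 := (@l1_norm R F d).

Lemma l1_norm_norm : is_norm l1.
Proof.
split=> [x x0|a x|x y].
- apply/matrixP => i j; rewrite ord1 mxE; apply: modulus_eq0.
  by move: x0 => /psumr_eq0P -> // k _; exact: modulus_ge0.
- by rewrite mulr_sumr; apply: eq_bigr => i _; rewrite mxE modulusM.
- by rewrite -big_split; apply: ler_sum => i _; rewrite mxE modulusD.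
Qed.

Lemma modulus_le_l1 (x : 'cV[K]_d) i : modulus (x i 0) <= l1 x.
Proof.
rewrite /l1_norm (bigD1 i) //= lerDl sumr_ge0 // => k _; exact: modulus_ge0.
Qed.

Lemma seminorm_le_l1 (w : 'cV[K]_d -> R) : is_seminorm w ->
  exists2 C, 0 < C & forall x, w x <= C * l1 x.
Proof.
move=> hw; exists (1 + \sum_i w (delta_mx i 0)) => [|x].
  by rewrite ltr_pwDl // sumr_ge0 // => i _; apply: seminorm_ge0.
rewrite {1}[x]matrix_sum_delta; under eq_bigr do rewrite big_ord1.
apply: le_trans (seminorm_sum hw _) _.
rewrite /l1_norm mulr_sumr; apply: ler_sum => i _.
rewrite (seminormZ hw) mulrC ler_wpM2r ?modulus_ge0 //.
rewrite (bigD1 i) //= addrCA lerDl addr_ge0 // sumr_ge0 // => k _.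
exact: seminorm_ge0.
Qed.

Lemma mx_norm_leP (n : nat) (u : 'rV[R]_n) (M : R) : 0 <= M ->
  reflect (forall i, `|u 0 i| <= M) (`|u| <= M).
Proof.
move=> M0; rewrite [`|u|]mx_normrE.
apply: (iffP (bigmax_leP _ _ _ _)) => [[_ uM] i|uM]; first exact: (uM (0, i)).
by split=> // -[i j] _ /=; rewrite ord1.
Qed.

(** Locally uniform properties of the points of a sphere are uniform: the sphere
is the image of a closed bounded set of real coordinate vectors [S], which is
compact.  The hypothesis that n dominates a multiple of [l1_norm] bounds the
coordinates. *)
Lemma compact_sphere_uniform (n : 'cV[K]_d -> R) (c : R) (Q : R -> 'cV[K]_d -> Prop) :
  is_seminorm n -> 0 < c -> (forall x, c * l1 x <= n x) ->
  (forall x0, n x0 = 1 -> exists t delta, [/\ 0 < t, 0 < delta &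
     forall x s, n (x - x0) < delta -> 0 < s -> s <= t -> Q s x]) ->
  exists2 t, 0 < t & forall x, n x = 1 -> Q t x.
Proof.
move=> hn c0 cl1 hQ.
have [j j1 coordE] := real_coordinates R F.
pose phi (u : 'rV[R]_(d + d)) : 'cV[K]_d := \col_i
  (real_scalar F (u 0 (lshift d i)) + real_scalar F (u 0 (rshift d i)) * j).
have phiB u v : phi u - phi v = phi (u - v).
  apply/matrixP => i k; rewrite !mxE.
  have rsB a b : real_scalar F (a - b) = real_scalar F a - real_scalar F b :> K.
    by apply: (addIr (real_scalar F b)); rewrite -real_scalarD !subrK.
  by rewrite !rsB mulrBl; ring.
have [C C0 nC] := seminorm_le_l1 hn.
have lip u : n (phi u) <= C * (2 * d%:R) * `|u|.
  apply: le_trans (nC _) _; rewrite -!mulrA ler_pM2l //.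
  rewrite mulrCA -[d in d%:R]card_ord mulr_natl -sumr_const.
  apply: ler_sum => i _; rewrite mxE.
  apply: le_trans (modulusD _ _) _.
  rewrite modulusM !modulus_real_scalar mulr_natl mulr2n lerD //.
    by have /mx_norm_leP := lexx `|u|; apply.
  rewrite -[leRHS]mulr1 ler_pM // ?modulus_ge0 //.
  by have /mx_norm_leP := lexx `|u|; apply.
have [L L0 lipL] : exists2 L, 0 < L & forall u, n (phi u) <= L * `|u|.
  exists (C * (2 * d%:R) + 1) => [|u]; last first.
    by apply: le_trans (lip u) _; rewrite ler_wpM2r // lerDl.
  by rewrite ltr_wpDl // !mulr_ge0 // ltW.
have ndist u v : `|n (phi u) - n (phi v)| <= L * `|u - v|.
  have h a b : n (phi a) - n (phi b) <= L * `|a - b|.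
    rewrite lerBlDr (le_trans _ (lerD (lipL (a - b)) (lexx _))) //.
    by rewrite -phiB (le_trans _ (seminormD hn _ _)) // subrK.
  by rewrite ler_norml lerNl opprB {1}distrC !h.
have near_dist (u : 'rV[R]_(d + d)) e : 0 < e -> \forall v \near u, `|u - v| < e.
  by move=> e0; apply/nbhs_ballP; exists e => // v; rewrite -ball_normE.
have ncont : continuous (n \o phi).
  move=> u; have FF := nbhs_filter u; apply/cvgrPdist_lt => e e0.
  apply: filterS (near_dist u _ (divr_gt0 e0 L0)) => v.
  by rewrite ltr_pdivlMr // mulrC; exact: le_lt_trans (ndist u v).
pose S := [set u : 'rV[R]_(d + d) | `|u| <= c^-1 /\ n (phi u) = 1].
have cS : compact S.
  apply: bounded_closed_compact.
    by exists c^-1; split=> [|M cM u [/le_trans uc _]]; 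
      [exact: num_real | apply/uc/ltW].
  have cle : closed ((fun u : 'rV[R]_(d + d) => `|u|) @^-1` [set r : R | r <= c^-1]).
    by apply: preimage_closed => [u _|]; [exact: norm_continuous | exact: closed_le].
  have ceq : closed ((n \o phi) @^-1` [set r : R | r = 1]).
    by apply: preimage_closed => [u _|]; [exact: ncont | exact: closed_eq].
  exact: closedI cle ceq.
have [t [t0 St]] : exists t, 0 < t /\ forall u, S u -> Q t (phi u).
  have hloc u : S u -> \forall v \near u & s \near (0 : R)^'+, Q s (phi v).
    move=> [_ nu].
    have [t [delta [t0 delta0 hQu]]] := hQ _ nu.
    exists ([set v | `|u - v| < delta / L], [set s | 0 < s /\ s <= t]).
      split=> /=; first exact/near_dist/divr_gt0.
      by apply: filterI; [exact: nbhs_right_gt | exact: nbhs_right_le].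
    move=> [v s] [/= uv [s0 st]]; apply: hQu => //.
    rewrite phiB; apply: le_lt_trans (lipL _) _.
    by rewrite distrC mulrC -ltr_pdivlMr.
  have /compact_near_coveringP/(_ R (0 : R)^'+ (fun t u => Q t (phi u)) _ hloc) := cS.
  move=> /(filterI (nbhs_right_gt 0)) /filter_ex [t [t0 St]].
  by exists t; split=> // u /St.
exists t => // x nx.
have /choice[ab abP] : forall i, exists ab : R * R,
    [/\ x i 0 = real_scalar F ab.1 + real_scalar F ab.2 * j,
      `|ab.1| <= modulus (x i 0) & `|ab.2| <= modulus (x i 0)].
  by move=> i; have [a [b abE]] := coordE (x i 0); exists (a, b).
pose u : 'rV[R]_(d + d) := row_mx (\row_i (ab i).1) (\row_i (ab i).2).
have phiu : phi u = x.
  apply/matrixP => i k; rewrite ord1 mxE row_mxEl row_mxEr !mxE.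
  by have [<-] := abP i.
rewrite -phiu; apply: St; split; last by rewrite phiu.
have xc i : modulus (x i 0) <= c^-1.
  apply: le_trans (modulus_le_l1 _ _) _.
  by rewrite -[leRHS]mulr1 -nx mulrC ler_pdivlMr // mulrC.
apply/mx_norm_leP => [|k]; first by rewrite invr_ge0 ltW.
case: (split_ordP k) => i ->; have [_ ai bi] := abP i.
  by rewrite row_mxEl mxE (le_trans ai).
by rewrite row_mxEr mxE (le_trans bi).
Qed.

End FiniteDimension.

Lemma unitmx_injective (K : fieldType) (n : nat) (P : 'M[K]_n) :
  (forall c : 'cV_n, P *m c = 0 -> c = 0) -> P \in unitmx.
Proof.
move=> Pinj; rewrite -row_full_unit -cokermx_eq0; apply/eqP/matrixP => i j.
have : P *m (cokermx P *m delta_mx j 0) = 0 :> 'cV_n.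
  by rewrite mulmxA mulmx_coker mul0mx.
by move=> /Pinj /matrixP/(_ i 0); rewrite -colE !mxE.
Qed.

Section NormEquivalence.
Variables (R : realType) (F : base_field) (d : nat).
Local Notation K := (scalars R F).
Local Notation l1 := (@l1_norm R F d).

Lemma norm_gt0 (N : 'cV[K]_d -> R) x : is_norm N -> x <> 0 -> 0 < N x.
Proof.
move=> hN x0; rewrite lt_neqAle (seminorm_ge0 (norm_seminorm hN)) andbT eq_sym.
by apply/eqP => /(is_norm_definite hN).
Qed.

Lemma unit_vector_decomposition (N : 'cV[K]_d -> R) x : is_norm N -> x <> 0 ->
  exists2 y, N y = 1 & x = real_scalar F (N x) *: y.
Proof.
move=> hN x0; have Nx := norm_gt0 hN x0.
have /[dup] hinv : real_scalar F (N x) * real_scalar F (N x)^-1 = 1.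
  by rewrite -real_scalarM divff ?gt_eqF // real_scalar1.
exists (real_scalar F (N x)^-1 *: x); last by rewrite scalerA hinv scale1r.
rewrite (seminormZr (norm_seminorm hN)) ger0_norm ?invr_ge0 ?ltW //.
by rewrite mulVf ?gt_eqF.
Qed.

(** Equivalence of norms: N is positive and continuous on the compact l1-sphere,
hence bounded below by a positive constant there. *)
Lemma norm_ge_l1 (N : 'cV[K]_d -> R) : is_norm N ->
  exists2 c, 0 < c & forall x, c * l1 x <= N x.
Proof.
move=> hN; have hw := norm_seminorm hN.
have hl1 := l1_norm_norm R F d; have hw1 := norm_seminorm hl1.
have [C C0 NC] := seminorm_le_l1 hw.
have [||x0 x01|t t0 tN] :=
  @compact_sphere_uniform _ _ _ l1 1 (fun t x => t <= N x) hw1.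
- exact: ltr01.
- by move=> x; rewrite mul1r.
- have Nx0 : 0 < N x0.
    apply: norm_gt0 => // x00; move: x01.
    by rewrite x00 (seminorm0 hw1) => /esym/eqP; rewrite oner_eq0.
  exists (N x0 / 2), (N x0 / 2 / C); split; [exact: divr_gt0| by rewrite !divr_gt0|].
  move=> x s xd s0 sN; apply: le_trans sN _.
  have := seminorm_leB hw x x0; have := NC (x - x0); move: xd.
  rewrite ltr_pdivlMr // mulrC.
  lra.
exists t => // x; have [->|/eqP x0] := eqVneq x 0.
  by rewrite (seminorm0 hw1) mulr0 (seminorm0 hw).
have [y y1 ->] := unit_vector_decomposition hl1 x0.
by rewrite !seminormZr // y1 mulr1 mulrC ler_wpM2l // tN.
Qed.

Lemma seminorm_le_norm (N w : 'cV[K]_d -> R) : is_norm N -> is_seminorm w ->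
  exists2 C : R, 0 < C & forall x, w x <= C * N x.
Proof.
move=> hN hw; have [c c0 cN] := norm_ge_l1 hN.
have [C C0 wC] := seminorm_le_l1 hw.
exists (C / c) => [|x]; first exact: divr_gt0.
apply: le_trans (wC x) _; rewrite -mulrA ler_pM2l // ler_pdivlMl //.
Qed.

Lemma mulmx_seminorm (w : 'cV[K]_d -> R) (M : 'M[K]_d) :
  is_seminorm w -> is_seminorm (fun x => w (M *m x)).
Proof.
move=> hw; split=> [a x|x y]; first by rewrite -scalemxAr (seminormZ hw).
by rewrite mulmxDr (seminormD hw).
Qed.

Lemma mulmx_bounded (N : 'cV[K]_d -> R) (M : 'M[K]_d) : is_norm N ->
  exists2 C, 0 < C & forall x, N (M *m x) <= C * N x.
Proof.
by move=> hN; apply/(seminorm_le_norm hN)/mulmx_seminorm/norm_seminorm.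
Qed.

Lemma exists_unit_vector (N : 'cV[K]_d -> R) : is_norm N -> (0 < d)%N ->
  exists x, N x = 1.
Proof.
move=> hN d0.
have [|y y1 _] := @unit_vector_decomposition N (const_mx 1) hN; last by exists y.
by move=> /matrixP/(_ (Ordinal d0) 0)/eqP; rewrite !mxE oner_eq0.
Qed.

End NormEquivalence.

(** * Orbits of an irreducible set *)

Section Frames.
Variables (R : realType) (F : base_field) (d : nat).
Local Notation K := (scalars R F).
Implicit Types A : set 'M[K]_d.

Lemma set_pow_growth A (w : 'cV[K]_d -> R) r :
  0 <= r -> (forall M x, A M -> w (M *m x) <= r * w x) ->
  forall n P x, set_pow A n P -> w (P *m x) <= r ^+ n * w x.
Proof.
move=> r0 wA; elim=> [|n IH] P x /=; first by move->; rewrite mul1mx mul1r.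
move=> [M AM [Q AQ <-]]; rewrite -mulmxA (le_trans (wA _ _ AM)) //.
by rewrite exprS -mulrA ler_wpM2l // IH.
Qed.

(** As long as the free family X spans a proper nonzero subspace, that subspace
is not invariant, so some M in A moves a member of X out of it: that vector
extends X, at the price of one more factor. *)
Lemma irreducible_free_orbit A x k : irreducible_set A -> x <> 0 -> (k < d)%N ->
  exists X : seq 'cV[K]_d, [/\ size X = k.+1, free X &
    forall y, y \in X -> orbit_upto A k x y].
Proof.
move=> Airr x0; elim: k => [|k IH] kd.
  exists [:: x]; split=> // [|y]; first by rewrite seq1_free; apply/eqP.
  rewrite mem_seq1 => /eqP ->; exists 1%:M; last exact: mul1mx.
  by exists 0%N.
have [X [sX fX AX]] := IH (ltnW kd).
have [M [y [AM yX MyX]]] : exists M y, [/\ A M, y \in X & M *m y \notin <<X>>%VS].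
  apply: contrapT => /forallNP hX.
  have [M AM z zX||] := Airr <<X>>%VS.
  - rewrite (coord_span (X := in_tuple X) zX) mulmx_sumr; apply: memv_suml => i _.
    rewrite -scalemxAr memvZ //; apply: contrapT => /negP MX.
    by apply: (hX M); exists (X`_i); split=> //; apply: mem_nth.
  - move=> X0; have := dim_span X; have /eqP := fX.
    by rewrite X0 dimv0 sX.
  - move=> XT; have := dim_span X; rewrite XT dimvf dim_matrix mulr1 sX.
    by rewrite leqNgt kd.
exists (M *m y :: X); split=> [||z]; first by rewrite /= sX.
  by rewrite free_cons MyX.
rewrite inE => /orP[/eqP->|/AX [P [j jk AP] <-]]; last first.
  by exists P => //; exists j => //; apply: leq_trans jk _.
have [P [j jk AP] <-] := AX _ yX.
exists (M *m P); last by rewrite mulmxA.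
by exists j.+1 => //; exists M => //; exists P.
Qed.

Definition frame (M : 'I_d -> 'M[K]_d) (x : 'cV[K]_d) : 'M[K]_d :=
  \matrix_(i, j) (M j *m x) i 0.

Lemma frameE M x (c : 'cV[K]_d) : frame M x *m c = \sum_j c j 0 *: (M j *m x).
Proof.
apply/matrixP => i k; rewrite ord1 mxE summxE; apply: eq_bigr => j _.
by rewrite !mxE mulrC.
Qed.

Lemma frameB M x y (c : 'cV[K]_d) :
  frame M (x - y) *m c = frame M x *m c - frame M y *m c.
Proof.
rewrite !frameE -sumrB; apply: eq_bigr => j _.
by rewrite mulmxBr scalerBr.
Qed.

Lemma irreducible_frame A x : (0 < d)%N -> irreducible_set A -> x <> 0 ->
  exists M : 'I_d -> 'M[K]_d,
    (forall j, (\bigcup_(k < d) set_pow A k) (M j)) /\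
    (forall c : 'cV[K]_d, frame M x *m c = 0 -> c = 0).
Proof.
move=> d0 Airr x0.
have [|X [sX fX AX]] := irreducible_free_orbit (k := d.-1) Airr x0.
  by rewrite prednK.
rewrite prednK // in sX; rewrite /orbit_upto prednK // in AX.
have /choice[M MP] : forall j : 'I_d, exists M : 'M[K]_d,
    (\bigcup_(k < d) set_pow A k) M /\ M *m x = X`_j.
  by move=> j; have [|M AM Mx] := AX X`_j; [rewrite mem_nth ?sX | exists M].
exists M; split=> [j|c Mc]; first by have [] := MP j.
have /eqP sX' := sX.
have := elimT (freeP (X := Tuple sX')) fX (fun j => c j 0).
have -> : \sum_i c i 0 *: (Tuple sX')`_i = 0.
  by rewrite -[RHS]Mc frameE; apply: eq_bigr => j _; have [_ ->] := MP j.
by move=> /(_ erefl) c0; apply/matrixP => i k; rewrite ord1 c0 mxE.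
Qed.

(** The constant k for which the norm of a combination of the vectors M j x0
dominates k times the l1-norm of its coefficients is halved at worst when x0 is
replaced by a near vector x.  So the frame at x is still invertible, and it
expresses every y of norm at most k / 2 with coefficients of l1-norm at most 1;
compactness of the sphere makes the radius uniform. *)
Lemma uniform_frame A (N : 'cV[K]_d -> R) : (0 < d)%N -> irreducible_set A ->
  is_norm N ->
  exists2 t, 0 < t & forall x y, N x = 1 -> N y <= t ->
    exists (M : 'I_d -> 'M[K]_d) (c : 'cV[K]_d),
     [/\ forall j, (\bigcup_(k < d) set_pow A k) (M j),
         y = frame M x *m c & l1_norm c <= 1].
Proof.
move=> d0 Airr hN; have hw := norm_seminorm hN.
pose Q t x := forall y, N y <= t -> exists (M : 'I_d -> 'M[K]_d) (c : 'cV[K]_d),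
     [/\ forall j, (\bigcup_(k < d) set_pow A k) (M j),
         y = frame M x *m c & l1_norm c <= 1].
suff [t t0 tQ] : exists2 t, 0 < t & forall x, N x = 1 -> Q t x.
  by exists t => // x y Nx Ny; exact: tQ.
have [e e0 eN] := norm_ge_l1 hN.
apply: (compact_sphere_uniform hw e0 eN) => x0 x01.
have x00 : x0 <> 0.
  by move=> x00; move: x01; rewrite x00 (seminorm0 hw) => /esym/eqP; rewrite oner_eq0.
have [M [AM M0]] := irreducible_frame d0 Airr x00.
(* c |-> N (frame M x0 *m c) is a norm on coefficient vectors *)
have [k k0 kN] : exists2 k, 0 < k & forall c, k * l1_norm c <= N (frame M x0 *m c).
  apply: norm_ge_l1; have [sZ sD] := mulmx_seminorm (frame M x0) hw.
  by split=> // c /(is_norm_definite hN)/M0.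
have [D D0 DN] : exists2 D, 0 < D &
    forall z (c : 'cV[K]_d), N (frame M z *m c) <= D * N z * l1_norm c.
  have /choice[C CP] : forall j, exists C, 0 < C /\ forall z, N (M j *m z) <= C * N z.
    by move=> j; have [C C0 CN] := mulmx_bounded (M j) hN; exists C.
  have CS j : C j <= 1 + \sum_i C i.
    rewrite (bigD1 j) //= addrCA lerDl addr_ge0 // sumr_ge0 // => i _.
    by have [/ltW] := CP i.
  exists (1 + \sum_j C j) => [|z c].
    by rewrite ltr_pwDl // sumr_ge0 // => j _; have [/ltW] := CP j.
  rewrite frameE (le_trans (seminorm_sum hw _)) // mulr_sumr.
  apply: ler_sum => j _; rewrite (seminormZ hw) mulrC ler_wpM2r ?modulus_ge0 //.
  have [_ CN] := CP j; rewrite (le_trans (CN z)) // ler_wpM2r //.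
  exact: seminorm_ge0.
exists (k / 2), (k / 2 / D); split; [exact: divr_gt0 | by rewrite !divr_gt0 |].
move=> x s xd s0 sk y Ns.
have kc c : k / 2 * l1_norm c <= N (frame M x *m c).
  have := DN (x - x0) c; rewrite frameB.
  have := seminorm_leB hw (frame M x *m c) (frame M x0 *m c).
  have := kN c.
  have : D * N (x - x0) * l1_norm c <= k / 2 * l1_norm c.
    rewrite ler_wpM2r ?(seminorm_ge0 (norm_seminorm (l1_norm_norm R F d))) //.
    by rewrite mulrC -ler_pdivlMr // ltW.
  lra.
have Pu : frame M x \in unitmx.
  apply: unitmx_injective => c Pc0; apply: (is_norm_definite (l1_norm_norm R F d)).
  apply/eqP; rewrite eq_le (seminorm_ge0 (norm_seminorm (l1_norm_norm R F d))) andbT.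
  by rewrite -(pmulr_rle0 _ (divr_gt0 k0 (ltr0n R 2))) -(seminorm0 hw) -Pc0 kc.
exists M, (invmx (frame M x) *m y); split=> //; first by rewrite mulKVmx.
have := kc (invmx (frame M x) *m y); rewrite mulKVmx // => h.
rewrite -(ler_pM2l (divr_gt0 k0 (ltr0n R 2))) mulr1.
exact: le_trans h (le_trans Ns sk).
Qed.

End Frames.

(** * Convex hulls and the measure of irreducibility *)

Section ConvexHulls.
Variables (R : realType) (F : base_field) (d : nat).
Local Notation K := (scalars R F).
Implicit Types (w N : 'cV[K]_d -> R) (S C : set 'cV[K]_d).

Lemma convex_hull_le w S D : is_seminorm w -> (forall z, S z -> w z <= D) ->
  forall z, convex_hull S z -> w z <= D.
Proof.
move=> hw SD; apply: (@smallest_sub _ _ _ [set z | w z <= D]) => // x y l.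
rewrite !inE /= => xD yD.
have l0 : 0 <= l%:num :> K by [].
have l1 : 0 <= 1 - l%:num :> K by rewrite subr_ge0.
apply: le_trans (seminormD hw _ _) _; rewrite !(seminormZ hw).
have <- : modulus l%:num * D + modulus (1 - l%:num : K) * D = D.
  rewrite -mulrDl -[RHS]mul1r; congr (_ * _).
  apply: (@real_scalar_inj R F).
  by rewrite real_scalarD !ge0_real_scalar // real_scalar1 addrC subrK.
by rewrite lerD // ler_wpM2l // modulus_ge0.
Qed.

Lemma convex_comb C x y (t : R) : convex_set C -> C x -> C y -> 0 <= t <= 1 ->
  C (real_scalar F t *: x + real_scalar F (1 - t) *: y).
Proof.
move=> cC Cx Cy /andP[t0 t1].
have rt0 : 0 <= real_scalar F t by rewrite -(real_scalar0 R F) real_scalar_le.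
have rt1 : real_scalar F t <= 1 by rewrite -(real_scalar1 R F) real_scalar_le.
have := cC x y (Itv01 rt0 rt1); rewrite !inE => /(_ Cx Cy).
suff -> : real_scalar F (1 - t) = 1 - real_scalar F t by [].
apply/eqP; rewrite -subr_eq0 opprB addrA -real_scalarD addrC.
by rewrite subrK real_scalar1 addNr.
Qed.

(** A combination whose weights sum to at most T is T times a point of C, the
missing weight being given to the point 0 of C.  Keeping T as a parameter lets
the induction peel off one term without renormalising the others. *)
Lemma convex_sum (I : Type) (s : seq I) (t : I -> R) (z : I -> 'cV[K]_d) C (T : R) :
  convex_set C -> C 0 -> (forall i, 0 <= t i) -> (forall i, C (z i)) ->
  \sum_(i <- s) t i <= T ->
  exists2 y, C y & \sum_(i <- s) real_scalar F (t i) *: z i = real_scalar F T *: y.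
Proof.
move=> cC C0 t0 Cz; elim: s T => [|i s IH] T.
  by exists 0; rewrite // big_nil scaler0.
rewrite !big_cons => sT; have [|y Cy ->] := IH (T - t i).
  by rewrite lerBrDl.
have T0 : 0 <= T by rewrite (le_trans _ sT) // addr_ge0 // sumr_ge0.
have tT : t i <= T by rewrite (le_trans _ sT) // lerDl sumr_ge0.
(* for T = 0 all weights vanish and any point of C serves *)
have [T00|Tn0] := eqVneq T 0.
  have ti0 : t i = 0 by apply/eqP; rewrite eq_le t0 -T00 tT.
  by exists 0; rewrite // T00 ti0 subr0 real_scalar0 !scale0r addr0.
exists (real_scalar F (t i / T) *: z i + real_scalar F (1 - t i / T) *: y).
  apply: convex_comb => //.
  by rewrite divr_ge0 // ler_pdivrMr ?mul1r // lt_neqAle eq_sym Tn0.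
rewrite scalerDr !scalerA -!real_scalarM mulrBr mulr1 mulrC divfK //.
Qed.

(** The set S has to be bounded: the supremum defining [inner_radius] has the
value 0 on a set of radii that is not bounded above. *)
Lemma inner_radius_ge N S D t : is_norm N -> (0 < d)%N ->
  (forall z, S z -> N z <= D) -> norm_ball N t `<=` convex_hull S ->
  t <= inner_radius N S.
Proof.
move=> hN d0 SD tS; apply: ub_le_sup => //; exists (Num.max 0 D) => s sS.
have hw := norm_seminorm hN; have [x x1] := exists_unit_vector hN d0.
rewrite le_max; have [s0|/ltW->//] := leP 0 s.
have Nsx : N (real_scalar F s *: x) = s by rewrite seminormZr // x1 mulr1 ger0_norm.
by rewrite -Nsx (convex_hull_le hw SD) ?orbT //; apply: sS; rewrite /norm_ball /= Nsx.
Qed.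

Lemma lt_inner_radius N S t : is_norm N -> t < inner_radius N S ->
  norm_ball N t `<=` convex_hull S.
Proof.
move=> hN /sup_gt[|s sS ts y yt]; last by apply: sS; apply: le_trans yt (ltW ts).
exists (-1) => y; rewrite /norm_ball /= leNgt => /negP[].
by rewrite (lt_le_trans _ (seminorm_ge0 (norm_seminorm hN) _)) // ltrN10.
Qed.

End ConvexHulls.

(** The one property of a measure of irreducibility c that the Lipschitz estimate
uses: on vectors of N-norm 1, the values of a seminorm that grows at most by the
factor r under A have ratios at most max (1, r ^ p) / c. *)
Definition dominates (R : realType) (F : base_field) (d : nat)
    (N : 'cV[scalars R F]_d -> R) (A : set 'M[scalars R F]_d) (p : nat) (c : R) :=
  forall w r, is_seminorm w -> 0 <= r ->
    (forall M x, A M -> w (M *m x) <= r * w x) ->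
  forall x y, c * w y * N x <= Num.max 1 (r ^+ p) * w x * N y.

Section Irreducibility.
Variables (R : realType) (F : base_field) (d : nat).
Local Notation K := (scalars R F).
Variables (N : 'cV[K]_d -> R) (A : set 'M[K]_d) (p : nat).
Hypothesis hN : is_norm N.
Let hNs := norm_seminorm hN.

Definition circled_orbit (x : 'cV[K]_d) : set 'cV[K]_d :=
  \bigcup_(a in [set a : K | `|a| = 1]) orbit_upto A p (a *: x).

Lemma orbit_upto_le w r : is_seminorm w -> 0 <= r ->
  (forall M x, A M -> w (M *m x) <= r * w x) ->
  forall x z, orbit_upto A p x z -> w z <= Num.max 1 (r ^+ p) * w x.
Proof.
move=> hw r0 wA x z [P [k kp AP] <-].
apply: le_trans (set_pow_growth r0 wA x AP) _.
rewrite ler_wpM2r ?(seminorm_ge0 hw) // le_max.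
have [r1|/ltW r1] := leP r 1; first by rewrite exprn_ile1.
by rewrite ler_weXn2l ?orbT.
Qed.

Lemma normr1_modulus (a : K) : `|a| = 1 -> modulus a = 1.
Proof.
by rewrite normr_scalarE -(real_scalar1 R F) => /real_scalar_inj.
Qed.

Lemma circled_orbit_le w r : is_seminorm w -> 0 <= r ->
  (forall M x, A M -> w (M *m x) <= r * w x) ->
  forall x z, circled_orbit x z -> w z <= Num.max 1 (r ^+ p) * w x.
Proof.
move=> hw r0 wA x z [a /= a1 /(orbit_upto_le hw r0 wA)].
by rewrite (seminormZ hw) (normr1_modulus a1) mul1r.
Qed.

Lemma orbit_upto_circled x :
  orbit_upto A p x `|` orbit_upto A p (- x) `<=` circled_orbit x.
Proof.
move=> z [] Az.
  by exists 1; rewrite /= ?normr1 ?scale1r.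
by exists (-1); rewrite /= ?normrN1 ?scaleN1r.
Qed.

(** A ball of a seminorm is convex, so it contains the convex hull of the orbit
as soon as it contains the orbit; the hull in turn contains an N-ball of any
radius below c. *)
Lemma inner_radius_dominates (S : 'cV[K]_d -> set 'cV[K]_d) :
  (forall x, S x `<=` circled_orbit x) ->
  0 < inf [set inner_radius N (S x) | x in [set x | N x = 1]] ->
  dominates N A p (inf [set inner_radius N (S x) | x in [set x | N x = 1]]).
Proof.
set c := inf _ => Sc c0 w r hw r0 wA x y.
have [->|/eqP x0] := eqVneq x 0.
  by rewrite (seminorm0 hNs) (seminorm0 hw) !(mulr0, mul0r).
have [->|/eqP y0] := eqVneq y 0.
  by rewrite (seminorm0 hNs) (seminorm0 hw) !(mulr0, mul0r).
have [x' x1 ->] := unit_vector_decomposition hN x0.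
have [y' y1 ->] := unit_vector_decomposition hN y0.
rewrite !seminormZr // x1 y1 !mulr1.
suff h : c * w y' <= Num.max 1 (r ^+ p) * w x'.
  have -> : forall a b : R, c * (b * w y') * a = (c * w y') * (a * b).
    by move=> *; ring.
  have -> : forall a b m : R, m * (a * w x') * b = (m * w x') * (a * b).
    by move=> *; ring.
  by rewrite ler_wpM2r // mulr_ge0.
suff h t : 0 < t -> t < c -> t * w y' <= Num.max 1 (r ^+ p) * w x'.
  set q := _ * w x' in h *.
  have q0 : 0 <= q by rewrite mulr_ge0 ?(seminorm_ge0 hw) // le_max ler01.
  have [-> |wy0] := eqVneq (w y') 0; first by rewrite mulr0.
  have wy : 0 < w y' by rewrite lt_neqAle eq_sym wy0 seminorm_ge0.
  rewrite -ler_pdivlMr // leNgt; apply/negP => qc.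
  have qw0 : 0 <= q / w y' by rewrite divr_ge0 // ltW.
  have := h ((q / w y' + c) / 2); rewrite -ler_pdivlMr //; lra.
move=> t0 tc.
have cx : c <= inner_radius N (S x').
  apply: ge_inf; last by exists x'.
  (* the infimum of a set without lower bound would be 0, against c > 0 *)
  pose V := [set inner_radius N (S x) | x in [set x | N x = 1]].
  by have [[_ h]|/inf_out ci] := pselect (has_inf V); [|move: c0; rewrite /c ci ltxx].
have hull : convex_hull (S x') (real_scalar F t *: y').
  apply: (lt_inner_radius hN (lt_le_trans tc cx)).
  by rewrite /norm_ball /= seminormZr // y1 mulr1 ger0_norm // ltW.
have := convex_hull_le hw (fun z Sz => circled_orbit_le hw r0 wA (Sc _ _ Sz)) hull.
by rewrite seminormZr // ger0_norm // ltW.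
Qed.

(** Coefficients of l1-norm at most 1 are nonnegative weights times scalars of
modulus 1, and these scalars are absorbed by the circled orbit; so the ball
provided by [uniform_frame] lies in the convex hull of that orbit. *)
Lemma circled_measure_gt0 : (0 < d)%N -> (d - 1 <= p)%N -> irreducible_set A ->
  (exists D, 0 <= D /\ forall M x, A M -> N (M *m x) <= D * N x) ->
  0 < circled_irreducibility_measure N p A.
Proof.
move=> d0 dp Airr [D [D0 DA]].
have [t t0 tF] := uniform_frame d0 Airr hN.
apply: lt_le_trans t0 _; apply: lb_le_inf.
  have [x x1] := exists_unit_vector hN d0.
  by exists (inner_radius N (circled_orbit x)); exists x.
move=> _ [x x1 <-]; rewrite -/(circled_orbit x).
apply: (inner_radius_ge hN d0 (D := Num.max 1 (D ^+ p))) => [z|y Ny].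
  by move=> /(circled_orbit_le hNs D0 DA); rewrite x1 mulr1.
have [M [c [AM -> c1]]] := tF _ _ x1 Ny.
(* the phases of the coefficients *)
pose s j : K := if c j 0 == 0 then 1 else c j 0 / real_scalar F (modulus (c j 0)).
have sE j : c j 0 = real_scalar F (modulus (c j 0)) * s j.
  rewrite /s; case: eqP => [->|/eqP c0]; first by rewrite modulus0 real_scalar0 mul0r.
  by rewrite mulrC divfK // -normr_scalarE normr_eq0.
have s1 j : `|s j| = 1.
  rewrite /s; case: eqP => [_|/eqP c0]; first by rewrite normr1.
  by rewrite -normr_scalarE normrM normfV normr_id divff // normr_eq0.
move=> C [cC SC].
have in_orb a j : `|a| = 1 -> circled_orbit x (a *: (M j *m x)).
  move=> a1; exists a => //; exists (M j); last by rewrite scalemxAr.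
  by have [k kd AMk] := AM j; exists k => //;
    rewrite /= (leq_trans kd) // -(subnK d0) addn1 ltnS.
have C0 : C 0.
  pose z := M (Ordinal d0) *m x.
  have C1 : C z by apply: SC; rewrite -[z]scale1r; apply/in_orb/normr1.
  have C2 : C (- z) by apply: SC; rewrite -scaleN1r; apply/in_orb/normrN1.
  have -> : 0 = real_scalar F 2^-1 *: z + real_scalar F (1 - 2^-1) *: - z.
    rewrite scalerN (_ : 1 - 2^-1 = 2^-1 :> R) ?subrr //; lra.
  by apply: convex_comb => //; lra.
have [y' Cy'] := @convex_sum _ _ _ _ (index_enum 'I_d) (fun j => modulus (c j 0))
  (fun j => s j *: (M j *m x)) C 1 cC C0 (fun j => modulus_ge0 _)
  (fun j => SC _ (in_orb _ j (s1 j))) c1.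
rewrite real_scalar1 scale1r frameE => yE.
suff -> : \sum_j c j 0 *: (M j *m x) = y' by [].
by rewrite -yE; apply: eq_bigr => j _; rewrite scalerA -sE.
Qed.

End Irreducibility.

Lemma irreducibility_measure_real (R : realType) (d : nat)
  (N : 'cV[scalars R RealScalars]_d -> R) (p : nat) A :
  irreducibility_measure N p A = circled_irreducibility_measure N p A.
Proof.
congr (inf _); apply: eq_imagel => x _; congr (inner_radius _ _).
apply/seteqP; split; first exact: orbit_upto_circled.
move=> z [a /= /eqP].
rewrite eqr_norml ler01 andbT => /orP[]/eqP->; rewrite ?scale1r ?scaleN1r.
  by left.
by right.
Qed.

(** * Operator norms and the Hausdorff distance *)

Section OperatorNorms.
Variables (R : realType) (F : base_field) (d : nat).
Local Notation K := (scalars R F).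
Variables (N : 'cV[K]_d -> R).
Hypotheses (hN : is_norm N) (d0 : (0 < d)%N).
Let hNs := norm_seminorm hN.
Implicit Types (A B : set 'M[K]_d) (M P : 'M[K]_d) (D : R).

(** The uniform bound on vectors stands for a bound on [set_norm], which is a
supremum and so carries information only on sets known to be bounded. *)
Definition opbound A D := forall M x, A M -> N (M *m x) <= D * N x.

Lemma entrywise_opbound A D : 0 <= D ->
  (forall M i j, A M -> modulus (M i j) <= D) -> exists2 C, 0 <= C & opbound A C.
Proof.
move=> D0 AD; have [c c0 cN] := norm_ge_l1 hN; have [C C0 NC] := seminorm_le_l1 hNs.
exists (C * (d%:R * D) / c) => [|M x AM].
  by rewrite divr_ge0 ?mulr_ge0 // ltW.
rewrite (le_trans (NC _)) // -2!mulrA ler_pM2l //.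
apply: (@le_trans _ _ (d%:R * D * l1_norm x)); last first.
  by rewrite -[leRHS]mulrA ler_wpM2l ?mulr_ge0 // ler_pdivlMl.
rewrite -mulrA -[X in X%:R]card_ord mulr_natl -sumr_const; apply: ler_sum => i _.
rewrite mxE /l1_norm mulr_sumr.
apply: (big_ind2 (fun a b => modulus a <= b)) => [|a1 b1 a2 b2 h1 h2|j _].
- by rewrite modulus0.
- exact: le_trans (modulusD _ _) (lerD h1 h2).
- by rewrite modulusM ler_wpM2r ?modulus_ge0 // AD.
Qed.

Lemma modulus_le_mx_norm M i j : real_scalar F (modulus (M i j)) <= `|M|.
Proof.
rewrite -normr_scalarE [leRHS]mx_normE.
rewrite -[X in X <= _]nngE num_le.
exact: (le_bigmax _ (fun i : 'I_d * 'I_d => `|M i.1 i.2|%:nng) (i, j)).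
Qed.

Lemma normed_opbound A (D : R) : (forall M, A M -> `|M| <= real_scalar F D) ->
  exists2 C, 0 <= C & opbound A C.
Proof.
move=> AD; apply: (@entrywise_opbound _ (Num.max 0 D)); first by rewrite le_max lexx.
move=> M i j /AD; rewrite le_max => /(le_trans (modulus_le_mx_norm M i j)).
by rewrite real_scalar_le orbC => ->.
Qed.

Lemma bounded_opbound A : bounded_set A -> exists2 C, 0 <= C & opbound A C.
Proof.
move=> /pinfty_ex_gt0[D D0 AD]; apply: (@normed_opbound _ (modulus D)) => M AM.
by rewrite ge0_real_scalar ?(ltW D0) //; exact: AD.
Qed.

(** The bound is obtained locally, from the ball of radius 1, and uniformly by
compactness of A; this argument serves both fields. *)
Lemma compact_opbound A : compact A -> exists2 C, 0 <= C & opbound A C.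
Proof.
move=> /compact_near_coveringP cA.
have := cA R +oo (fun D M => `|M| <= real_scalar F D) _.
case=> [M AM|D [_ DA]].
  pose r := modulus (`|M| : K) + 1.
  exists (ball M 1, [set D : R | r <= D]).
    split; last by apply: nbhs_pinfty_ge; exact: num_real.
    by apply/nbhs_ballP; exists 1 => //=; exact: ltr01.
  move=> [M' D] [/=]; rewrite -ball_normE /= distrC => MM' rD.
  rewrite -[M'](subrK M) (le_trans (ler_normD _ _)) //.
  apply: (@le_trans _ _ (real_scalar F r)); last by rewrite real_scalar_le.
  by rewrite /r real_scalarD ge0_real_scalar // real_scalar1 addrC lerD // ltW.
apply: (@normed_opbound _ (D + 1)) => M AM; apply: DA => //.
by rewrite ltrDl.
Qed.

Lemma opnorm_le M D : (forall x, N (M *m x) <= D * N x) -> opnorm N M <= D.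
Proof.
move=> MD; have [x x1] := exists_unit_vector hN d0.
apply: ge_sup; first by exists (N (M *m x)); exists x.
by move=> _ [y y1 <-]; rewrite -[D]mulr1 -y1.
Qed.

Lemma opnormP M x : N (M *m x) <= opnorm N M * N x.
Proof.
have [->|/eqP x0] := eqVneq x 0.
  by rewrite mulmx0 (seminorm0 hNs) mulr0.
have [y y1 ->] := unit_vector_decomposition hN x0.
rewrite -scalemxAr !seminormZr // y1 mulr1 mulrC ler_wpM2r //.
apply: ub_le_sup; last by exists y.
have [C C0 MC] := mulmx_bounded M hN.
by exists C => _ [z z1 <-]; rewrite -[C]mulr1 -z1.
Qed.

Lemma opnorm_ge0 M : 0 <= opnorm N M.
Proof.
have [x x1] := exists_unit_vector hN d0.
by rewrite -[opnorm N M]mulr1 -x1 (le_trans _ (opnormP M x)) ?seminorm_ge0.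
Qed.

Lemma set_norm_le A D : A !=set0 -> opbound A D -> set_norm N A <= D.
Proof.
move=> [M AM] AD; apply: ge_sup; first by exists (opnorm N M); exists M.
by move=> _ [P AP <-]; apply: opnorm_le => x; apply: AD.
Qed.

Lemma opnorm_le_set_norm A D M : opbound A D -> A M -> opnorm N M <= set_norm N A.
Proof.
move=> AD AM; apply: ub_le_sup; last by exists M.
by exists D => _ [P AP <-]; apply: opnorm_le => x; apply: AD.
Qed.

Lemma set_norm_opbound A D : opbound A D -> opbound A (set_norm N A).
Proof.
move=> AD M x AM; rewrite (le_trans (opnormP M x)) // ler_wpM2r ?seminorm_ge0 //.
exact: opnorm_le_set_norm AD AM.
Qed.

Lemma set_norm_ge0 A D : A !=set0 -> opbound A D -> 0 <= set_norm N A.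
Proof.
by move=> [M AM] AD; rewrite (le_trans (opnorm_ge0 M)) // (opnorm_le_set_norm AD).
Qed.

Lemma sup_inf_opnorm A B D E : B !=set0 -> opbound A D -> opbound B E ->
  forall M, A M -> 
  0 <= inf [set opnorm N (M - P) | P in B] <=
    sup [set inf [set opnorm N (M - P) | P in B] | M in A].
Proof.
move=> [P0 BP0] AD BE M AM.
have lb (Q : 'M[K]_d) : has_lbound [set opnorm N (Q - P) | P in B].
  by exists 0 => _ [P _ <-]; exact: opnorm_ge0.
apply/andP; split.
  by apply: lb_le_inf; [exists (opnorm N (M - P0)); exists P0
    | move=> _ [P _ <-]; exact: opnorm_ge0].
apply: ub_le_sup; last by exists M.
exists (D + E) => _ [Q AQ <-].
apply: le_trans (ge_inf (lb Q) _) _; first by exists P0.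
apply: opnorm_le => x; rewrite mulmxBl mulrDl.
by rewrite (le_trans (seminormD hNs _ _)) // seminormN // lerD ?AD ?BE.
Qed.

Lemma sup_inf_opnorm_lt A B D E h : B !=set0 -> opbound A D -> opbound B E ->
  sup [set inf [set opnorm N (M - P) | P in B] | M in A] < h ->
  forall M, A M -> exists2 P, B P & forall x, N ((M - P) *m x) <= h * N x.
Proof.
move=> B0 AD BE hh M AM.
have /andP[_ le] := sup_inf_opnorm B0 AD BE AM.
have [|_ [P BP <-] Ph] := inf_lt _ (le_lt_trans le hh).
  by have [P BP] := B0; exists (opnorm N (M - P)); exists P.
exists P => // x; rewrite (le_trans (opnormP _ _)) // ler_wpM2r ?seminorm_ge0 //.
exact: ltW.
Qed.

Lemma opnormB M P : opnorm N (M - P) = opnorm N (P - M).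
Proof.
congr (sup _); apply: eq_imagel => x _.
by rewrite -opprB mulNmx seminormN.
Qed.

Lemma hausdorff_distanceC A B : hausdorff_distance N A B = hausdorff_distance N B A.
Proof.
rewrite /hausdorff_distance maxC; congr (Num.max (sup _) (sup _));
  by apply: eq_imagel => M _; congr (inf _); apply: eq_imagel => P _; exact: opnormB.
Qed.

Lemma hausdorff_distance_lt A B D E h : B !=set0 -> opbound A D -> opbound B E ->
  hausdorff_distance N A B < h ->
  forall M, A M -> exists2 P, B P & forall x, N ((M - P) *m x) <= h * N x.
Proof.
move=> B0 AD BE; rewrite /hausdorff_distance gt_max => /andP[+ _].
exact: sup_inf_opnorm_lt AD BE.
Qed.

Lemma hausdorff_distance_ge0 A B D E : A !=set0 -> B !=set0 ->
  opbound A D -> opbound B E -> 0 <= hausdorff_distance N A B.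
Proof.
move=> [M AM] B0 AD BE; have /andP[i0 iS] := sup_inf_opnorm B0 AD BE AM.
by rewrite /hausdorff_distance le_max (le_trans i0 iS).
Qed.

End OperatorNorms.

(** * The joint spectral radius *)

Section LimitSuperior.
Variable R : realType.
Implicit Type u : nat -> R.

Lemma geometric_dominates (a b C : R) : 0 <= a -> a < b -> 0 < C ->
  exists n0, forall n, (n0 <= n)%N -> C * a ^+ n <= b ^+ n.
Proof.
move=> a0 ab C0; have b0 : 0 < b by apply: le_lt_trans ab.
have ab1 : `|a / b| < 1.
  by rewrite ger0_norm ?divr_ge0 ?(ltW b0) // ltr_pdivrMr // mul1r.
have C1 : 0 < C^-1 by rewrite invr_gt0.
have [n0 _ h] := cvgr_le _ (cvg_expr ab1) _ C1.
exists n0 => n /h /=; rewrite expr_div_n ler_pdivrMr ?exprn_gt0 //.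
by rewrite ler_pdivlMl.
Qed.

Lemma bounded_fun_itv u D : (forall n, 0 <= u n <= D) -> bounded_fun (u : nat -> R^o).
Proof.
move=> uD; exists D; split=> [|M DM n _]; first exact: num_real.
by have /andP[u0 un] := uD n; rewrite /= ger0_norm // (le_trans un) // ltW.
Qed.

Lemma limn_sup_le u D r n0 : (forall n, 0 <= u n <= D) ->
  (forall n, (n0 <= n)%N -> u n <= r) -> limn_sup u <= r.
Proof.
move=> /bounded_fun_itv bu ur; rewrite limn_supE //.
apply: (@le_trans _ _ (sups u n0)).
  by apply: ge_inf; [exact: bounded_fun_has_lbound_sups | exists n0].
by apply: ge_sup; [exists (u n0), n0 => /= | move=> _ [n /= n0n <-]; apply: ur].
Qed.

Lemma limn_sup_ge u D r n0 : (forall n, 0 <= u n <= D) ->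
  (forall n, (n0 <= n)%N -> r <= u n) -> r <= limn_sup u.
Proof.
move=> /bounded_fun_itv bu ur; rewrite limn_supE //.
apply: lb_le_inf; first by exists (sups u 0), 0%N.
move=> _ [n _ <-]; apply: (@le_trans _ _ (u (maxn n n0))).
  by apply: ur; exact: leq_maxr.
apply: ub_le_sup; last by exists (maxn n n0) => //=; exact: leq_maxl.
exact/has_ubound_sdrop/bounded_fun_has_ubound.
Qed.

Lemma limn_sup_lt u D r : (forall n, 0 <= u n <= D) -> limn_sup u < r ->
  exists n0, forall n, (n0 <= n)%N -> u n <= r.
Proof.
move=> /bounded_fun_itv bu; rewrite limn_supE // => /inf_lt[|_ [n0 _ <-] ur].
  by exists (sups u 0), 0%N.
exists n0 => n n0n; rewrite (le_trans _ (ltW ur)) //.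
apply: ub_le_sup; last by exists n.
exact/has_ubound_sdrop/bounded_fun_has_ubound.
Qed.

Lemma root_exprn (x : R) n : 0 <= x -> (0 < n)%N -> (x `^ n%:R^-1) ^+ n = x.
Proof.
move=> x0 n0.
by rewrite -powR_mulrn ?powR_ge0 // -powRrM mulVf ?powRr1 // pnatr_eq0 -lt0n.
Qed.

Lemma root_le (x r : R) n : 0 <= x -> 0 <= r -> (0 < n)%N ->
  (x `^ n%:R^-1 <= r) = (x <= r ^+ n).
Proof.
move=> x0 r0 n0; rewrite -[in RHS](root_exprn x0 n0) ler_pXn2r // nnegrE.
exact: powR_ge0.
Qed.

Lemma root_ge (x r : R) n : 0 <= x -> 0 <= r -> (0 < n)%N ->
  (r <= x `^ n%:R^-1) = (r ^+ n <= x).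
Proof.
move=> x0 r0 n0; rewrite -[in RHS](root_exprn x0 n0) ler_pXn2r // nnegrE.
exact: powR_ge0.
Qed.

End LimitSuperior.

Section JointSpectralRadius.
Variables (R : realType) (F : base_field) (d : nat).
Local Notation K := (scalars R F).
Variables (N : 'cV[K]_d -> R).
Hypotheses (hN : is_norm N) (d0 : (0 < d)%N).
Let hNs := norm_seminorm hN.
Variables (A : set 'M[K]_d) (D : R).
Hypotheses (A0 : A !=set0) (D0 : 0 <= D) (AD : opbound N A D).
Local Notation rho := (joint_spectral_radius N A).

Lemma set_pow_nonempty n : set_pow A n !=set0.
Proof.
elim: n => [|n [P AP]]; first by exists 1%:M.
by have [M AM] := A0; exists (M *m P), M => //; exists P.
Qed.

Lemma set_powD m n P : set_pow A (m + n) P ->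
  exists P1 P2, [/\ set_pow A m P1, set_pow A n P2 & P = P1 *m P2].
Proof.
elim: m P => [|m IH] P; first by exists 1%:M, P; rewrite mul1mx.
move=> [M AM [Q /IH[P1 [P2 [AP1 AP2 ->]]] <-]].
exists (M *m P1), P2; split=> //; last by rewrite mulmxA.
by exists M => //; exists P1.
Qed.

Lemma set_pow_mulr n M P : A M -> set_pow A n P -> set_pow A n.+1 (P *m M).
Proof.
move=> AM; elim: n P => [|n IH] P /=.
  by move->; exists M => //; exists 1%:M; rewrite // mul1mx mulmx1.
move=> [M' AM' [Q AQ <-]]; exists M' => //; exists (Q *m M); first exact: IH.
by rewrite mulmxA.
Qed.

Lemma set_pow_opbound n : opbound N (set_pow A n) (D ^+ n).
Proof. by move=> P x; apply: set_pow_growth. Qed.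

Let root_bounds n : 0 <= set_norm N (set_pow A n) `^ n%:R^-1 <= Num.max 1 D.
Proof.
have hA := set_pow_nonempty; have hB := set_pow_opbound.
rewrite powR_ge0 /=; case: n => [|n]; first by rewrite invr0 powRr0 le_max lexx.
rewrite root_le ?(set_norm_ge0 hN d0 (hA _) (hB _)) // ?le_max ?ler01 //.
apply: le_trans (set_norm_le hN d0 (hA _) (hB _)) _.
by rewrite lerXn2r ?nnegrE ?le_max ?ler01 ?lexx ?orbT.
Qed.

Lemma jsr_le r C : 0 <= r -> 0 < C ->
  (forall n P x, set_pow A n P -> N (P *m x) <= C * r ^+ n * N x) -> rho <= r.
Proof.
move=> r0 C0 hr; apply/ler_addgt0Pr => e e0.
have re : r < r + e by rewrite ltrDl.
have [n0 hn0] := geometric_dominates r0 re C0.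
apply: (limn_sup_le (n0 := maxn 1 n0) root_bounds) => n.
rewrite geq_max => /andP[n1 n0n].
have Pn0 := set_norm_ge0 hN d0 (set_pow_nonempty n) (set_pow_opbound (n := n)).
rewrite root_le ?addr_ge0 ?(ltW e0) //.
apply: le_trans (hn0 _ n0n).
by apply: (set_norm_le hN d0 (set_pow_nonempty n)) => P x /hr.
Qed.

Lemma jsr_ge0 : 0 <= rho.
Proof.
by apply: (limn_sup_ge (n0 := 0) root_bounds) => n _; case/andP: (root_bounds n).
Qed.

Lemma jsr_ge r c : 0 <= r -> 0 < c ->
  (forall n, exists P x, [/\ set_pow A n P, 0 < N x &
     c * r ^+ n * N x <= N (P *m x)]) -> r <= rho.
Proof.
move=> r0 c0 hr; rewrite leNgt; apply/negP => rr.
have rho0 := jsr_ge0.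
pose q := (rho + r) / 2.
have q0 : 0 <= q by rewrite divr_ge0 // addr_ge0.
have [n0 hn0] : exists n0, forall n, (n0 <= n)%N -> c^-1 * q ^+ n <= r ^+ n.
  by apply: geometric_dominates; rewrite ?invr_gt0 // /q; lra.
suff : q <= rho by rewrite /q; lra.
apply: (limn_sup_ge (n0 := maxn 1 n0) root_bounds) => n.
rewrite geq_max => /andP[n1 n0n].
have Pn0 := set_norm_ge0 hN d0 (set_pow_nonempty n) (set_pow_opbound (n := n)).
rewrite root_ge //.
have [P [x [AP x0 Px]]] := hr n.
rewrite -(ler_pM2r x0).
apply: le_trans (set_norm_opbound hN d0 (set_pow_opbound (n := n)) x AP).
rewrite (le_trans _ Px) // ler_wpM2r ?(ltW x0) //.
by rewrite -ler_pdivrMl // hn0.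
Qed.

Lemma jsr_le_set_norm : rho <= set_norm N A.
Proof.
have s0 := set_norm_ge0 hN d0 A0 AD.
apply: (jsr_le s0 ltr01) => n P x AP; rewrite mul1r.
exact: set_pow_growth s0 (set_norm_opbound hN d0 AD) _ _ _ AP.
Qed.

(** Any growth rate r > 0 holds for the finitely many lengths below m, at the
price of a constant. *)
Lemma opbound_finite r m : 0 < r -> exists2 C, 0 < C &
  forall n P x, (n < m)%N -> set_pow A n P -> N (P *m x) <= C * r ^+ n * N x.
Proof.
move=> r0; have t0 i : 0 <= D ^+ i / r ^+ i by rewrite divr_ge0 ?exprn_ge0 // ltW.
exists (1 + \sum_(i < m) D ^+ i / r ^+ i) => [|n P x nm AP].
  by rewrite ltr_pwDl // sumr_ge0.
rewrite (le_trans (set_pow_opbound x AP)) // ler_wpM2r ?seminorm_ge0 //.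
rewrite -ler_pdivrMr ?exprn_gt0 // (bigD1 (Ordinal nm)) //= addrCA lerDl.
by rewrite addr_ge0 // sumr_ge0.
Qed.

Lemma jsr_lt r : rho < r -> exists2 C, 0 < C &
  forall n P x, set_pow A n P -> N (P *m x) <= C * r ^+ n * N x.
Proof.
move=> rr; have r0 : 0 < r by apply: le_lt_trans rr; exact: jsr_ge0.
have [n0 hn0] := limn_sup_lt root_bounds rr.
have [C C0 hC] := opbound_finite (maxn 1 n0) r0.
exists (1 + C) => [|n P x AP]; first by rewrite addr_gt0.
have rN : 0 <= r ^+ n * N x by rewrite mulr_ge0 ?exprn_ge0 ?seminorm_ge0 // ltW.
rewrite -mulrA mulrDl mul1r.
have Pn0 := set_norm_ge0 hN d0 (set_pow_nonempty n) (set_pow_opbound (n := n)).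
have [nm|] := ltnP n (maxn 1 n0).
  by rewrite (le_trans (hC _ _ x nm AP)) // -mulrA lerDr.
rewrite geq_max => /andP[n1 /hn0]; rewrite root_le ?(ltW r0) //.
move=> h; apply: (@le_trans _ _ (r ^+ n * N x)); last first.
  by rewrite lerDl mulr_ge0 // ltW.
rewrite (le_trans (set_norm_opbound hN d0 (set_pow_opbound (n := n)) x AP)) //.
by rewrite ler_wpM2r ?seminorm_ge0.
Qed.

(** If all products of m factors contracted by k * rho ^ m with k < 1, cutting
long products into blocks of m factors would bound their growth by the rate
s * rho, where s < 1 is an m-th root of k. *)
Lemma jsr_no_contraction k m : 0 < rho -> k < 1 -> (0 < m)%N ->
  ~ (forall P x, set_pow A m P -> N (P *m x) <= k * rho ^+ m * N x).
Proof.
(* k may be 0 or negative, while the rate s * rho has to be positive *)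
move=> rho0 k1 m0 hk; pose s := Num.max k 2^-1 `^ m%:R^-1.
have s0 : 0 < s by apply: powR_gt0; rewrite lt_max invr_gt0 ltr0n orbT.
have sm : s ^+ m = Num.max k 2^-1.
  by rewrite root_exprn // le_max invr_ge0 ler0n orbT.
have s1 : s < 1.
  rewrite -(ltr_pXn2r m0) ?nnegrE ?ltW // sm expr1n gt_max k1 /=; lra.
have q0 : 0 < s * rho by rewrite mulr_gt0.
have [C C0 hC] := opbound_finite m q0.
have : rho <= s * rho.
  apply: (jsr_le (ltW q0) C0) => n.
  have [l] := ubnP n; elim: l n => // l IH n nl P x AP.
  have [nm|mn] := ltnP n m; first exact: hC.
  move: AP; rewrite -(subnKC mn) => /set_powD[P1 [P2 [AP1 AP2 ->]]].
  rewrite -mulmxA (le_trans (hk _ _ AP1)) //.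
  have h2 := IH (n - m)%N _ P2 x AP2.
  apply: (@le_trans _ _ ((s * rho) ^+ m * N (P2 *m x))).
    rewrite ler_wpM2r ?seminorm_ge0 // exprMn ler_wpM2r ?exprn_ge0 ?(ltW rho0) //.
    by rewrite sm le_max lexx.
  rewrite exprD; move: h2; set a := _ ^+ m; set b := _ ^+ (n - m) => h2.
  have -> : C * (a * b) * N x = a * (C * b * N x) by ring.
  rewrite ler_wpM2l ?exprn_ge0 ?(ltW q0) // h2 //.
  by rewrite -ltnS (leq_trans _ nl) // ltnS ltn_subrL m0 (leq_trans m0 mn).
by rewrite -{1}[rho]mul1r ler_pM2r // leNgt s1.
Qed.

End JointSpectralRadius.

(** Passage to the limit, from the right, in the bounds in which a rate r enters
through max (1, r ^ p) and polynomially. *)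
Lemma le_right_limit_max_exprn (R : realType) (q0 q1 : {poly R}) (p : nat) (a b : R) :
  (forall r, a < r -> b <= q0.[r] + Num.max 1 (r ^+ p) * q1.[r]) ->
  b <= q0.[a] + Num.max 1 (a ^+ p) * q1.[a].
Proof.
move=> hb; pose g := (fun r : R => q0.[r] + Num.max 1 ('X^p).[r] * q1.[r]).
have cg : {for a, continuous g}.
  apply: (@continuousD _ R^o); first exact: continuous_horner.
  apply: continuousM; last exact: continuous_horner.
  apply: (@continuous_max R R^o (cst 1) (horner 'X^p) a); first exact: cst_continuous.
  exact: continuous_horner.
have := cvgr_to_ge (cvg_at_right_filter cg) (b := b).
rewrite /g hornerXn; apply; near=> r.
by rewrite hornerXn; apply: hb; near: r; exact: nbhs_right_gt.
Unshelve. all: by end_near. Qed.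

(** * Seminorms built from long products *)

Section TailSup.
Variables (R : realType) (F : base_field) (d : nat).
Local Notation K := (scalars R F).
Variables (N : 'cV[K]_d -> R) (A : set 'M[K]_d) (r C : R).
Hypotheses (hN : is_norm N) (A0 : A !=set0) (r0 : 0 < r).
Hypothesis growth : forall n P x, set_pow A n P -> N (P *m x) <= C * r ^+ n * N x.
Let hNs := norm_seminorm hN.

(** The decreasing limit of these seminorms as m grows would be a Barabanov norm,
for which the supremum over A of the values at M x is r times the value at x.
Before the limit the same identity holds exactly between two consecutive levels
([tail_sup_mulmx], [tail_sup_attained]), with no compactness argument. *)
Definition tail_sup (m : nat) (x : 'cV[K]_d) : R :=
  sup [set y | exists k P, [/\ (m <= k)%N, set_pow A k P & y = N (P *m x) / r ^+ k]].

Lemma tail_sup_le m x b :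
  (forall k P, (m <= k)%N -> set_pow A k P -> N (P *m x) / r ^+ k <= b) ->
  tail_sup m x <= b.
Proof.
move=> hb; apply: ge_sup => [|_ [k [P [mk AP ->]]]]; last exact: hb.
by have [P AP] := set_pow_nonempty A0 m; exists (N (P *m x) / r ^+ m), m, P.
Qed.

Lemma growth_div k P x : set_pow A k P -> N (P *m x) / r ^+ k <= C * N x.
Proof.
by move=> AP; rewrite ler_pdivrMr ?exprn_gt0 // mulrAC growth.
Qed.

Lemma le_tail_sup m k P x : (m <= k)%N -> set_pow A k P ->
  N (P *m x) / r ^+ k <= tail_sup m x.
Proof.
move=> mk AP; apply: ub_le_sup; last by exists k, P.
by exists (C * N x) => _ [j [Q [_ AQ ->]]]; exact: growth_div.
Qed.

Lemma tail_sup_bounded m x : tail_sup m x <= C * N x.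
Proof. by apply: tail_sup_le => k P _; exact: growth_div. Qed.

Lemma tail_sup_antitone m n x : (m <= n)%N -> tail_sup n x <= tail_sup m x.
Proof.
by move=> mn; apply: tail_sup_le => k P nk; apply/le_tail_sup/(leq_trans mn).
Qed.

Lemma tail_sup_seminorm m : is_seminorm (tail_sup m).
Proof.
have scale_le a x : tail_sup m (a *: x) <= modulus a * tail_sup m x.
  apply: tail_sup_le => k P mk AP; rewrite -scalemxAr (seminormZ hNs) -mulrA.
  by rewrite ler_wpM2l ?modulus_ge0 // le_tail_sup.
split=> [a x|x y]; last first.
  apply: tail_sup_le => k P mk AP; rewrite mulmxDr.
  apply: le_trans (lerD (le_tail_sup x mk AP) (le_tail_sup y mk AP)).
  by rewrite -mulrDl ler_wpM2r ?(seminormD hNs) // invr_ge0 exprn_ge0 // ltW.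
apply/eqP; rewrite eq_le scale_le /=.
have [->|a0] := eqVneq a 0.
  rewrite modulus0 mul0r scale0r.
  have [P AP] := set_pow_nonempty A0 m; apply: le_trans (le_tail_sup 0 (leqnn m) AP).
  by rewrite mulmx0 (seminorm0 hNs) mul0r.
have ma0 : 0 < modulus a.
  by rewrite lt_neqAle modulus_ge0 andbT eq_sym; apply: contra_neq a0 => /modulus_eq0.
have := scale_le a^-1 (a *: x); rewrite scalerA mulVf // scale1r.
by rewrite -(ler_pM2l ma0) mulrA -modulusM divff // modulus1 mul1r.
Qed.

Lemma tail_sup_mulmx m M x : A M -> tail_sup m (M *m x) <= r * tail_sup m.+1 x.
Proof.
move=> AM; apply: tail_sup_le => k P mk AP; rewrite mulmxA.
have := le_tail_sup x (mk : (m.+1 <= k.+1)%N) (set_pow_mulr AM AP).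
rewrite -(ler_pM2l r0); apply: le_trans.
by rewrite exprS invfM mulrCA mulVKf // gt_eqF.
Qed.

Lemma tail_sup_mulmx_le m M x : A M -> tail_sup m (M *m x) <= r * tail_sup m x.
Proof.
move=> AM; rewrite (le_trans (tail_sup_mulmx m x AM)) // ler_wpM2l ?(ltW r0) //.
exact: tail_sup_antitone.
Qed.

Lemma tail_sup_attained m x b : b < tail_sup m.+1 x ->
  exists2 M, A M & r * b < tail_sup m (M *m x).
Proof.
move=> /sup_gt[|_ [k [P [mk AP ->]]] bP].
  by have [P AP] := set_pow_nonempty A0 m.+1; exists (N (P *m x) / r ^+ m.+1), m.+1, P.
case: k mk AP bP => // k mk; rewrite -addn1 => /set_powD[Q [M [AQ AM ->]]] bP.
have {}AM : A M by case: AM => M' AM' [_ -> <-]; rewrite mulmx1.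
exists M => //; apply: lt_le_trans (le_tail_sup (M *m x) (mk : (m <= k)%N) AQ).
rewrite -mulmxA addn1 exprSr invfM mulrA in bP.
by rewrite mulrC -ltr_pdivlMr.
Qed.

End TailSup.

(** * The Lipschitz estimate *)

Section LipschitzBounds.
Variables (R : realType) (F : base_field) (d : nat).
Local Notation K := (scalars R F).
Variables (N : 'cV[K]_d -> R) (A B : set 'M[K]_d) (p : nat) (c D E h : R).
Hypotheses (hN : is_norm N) (d0 : (0 < d)%N).
Hypotheses (A0 : A !=set0) (D0 : 0 <= D) (AD : opbound N A D).
Hypotheses (B0 : B !=set0) (E0 : 0 <= E) (BE : opbound N B E).
Hypotheses (c0 : 0 < c) (Ac : dominates N A p c).
Let hNs := norm_seminorm hN.
Local Notation rho := (joint_spectral_radius N).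
Local Notation kappa r := (Num.max 1 (r ^+ p) / c).

Let max_gt0 (r : R) : 0 < Num.max 1 (r ^+ p).
Proof. by rewrite lt_max ltr01. Qed.

Lemma dominates_eccentricity w r : is_seminorm w -> 0 <= r ->
  (forall M x, A M -> w (M *m x) <= r * w x) ->
  forall x y, x <> 0 -> N y <= h * N x -> w y <= kappa r * h * w x.
Proof.
move=> hw r0 wA x y x0 yx; have Nx := norm_gt0 hN x0.
rewrite -(ler_pM2r Nx) -(ler_pM2l c0) mulrA (le_trans (Ac hw r0 wA x y)) //.
have -> : c * (kappa r * h * w x * N x) = Num.max 1 (r ^+ p) * w x * (h * N x).
  by field; rewrite gt_eqF.
by rewrite ler_wpM2l // mulr_ge0 ?(seminorm_ge0 hw) // ltW.
Qed.

(** The seminorm w is an extremal norm for the rate r: it lies above N and grows at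
most by r under A.  Its eccentricity is bounded by c alone, which makes the
constant in front of r ^ n independent of the growth constant C obtained from
r > rho A. *)
Lemma growth_gt r : rho A < r ->
  forall n P x, set_pow A n P -> c * N (P *m x) <= Num.max 1 (r ^+ p) * r ^+ n * N x.
Proof.
move=> rr n P x AP; have [C C0 hC] := jsr_lt hN d0 A0 D0 AD rr.
have r0 : 0 < r by apply: le_lt_trans rr; exact: (jsr_ge0 hN d0 A0 D0 AD).
have hw := tail_sup_seminorm hN A0 r0 hC 0; set w := tail_sup N A r 0 in hw.
have wA M z : A M -> w (M *m z) <= r * w z by exact: (tail_sup_mulmx_le A0 r0 hC).
have [->|/eqP x0] := eqVneq x 0.
  by rewrite mulmx0 (seminorm0 hNs) !mulr0.
have Nw : N x <= w x.
  have := le_tail_sup r0 hC x (leqnn 0) (erefl : set_pow A 0 1%:M).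
  by rewrite mul1mx expr0 divr1.
have wx : 0 < w x by rewrite (lt_le_trans _ Nw) // norm_gt0.
rewrite -(ler_pM2r wx) mulrAC (le_trans (Ac hw (ltW r0) wA (P *m x) x)) //.
have -> : Num.max 1 (r ^+ p) * r ^+ n * N x * w x =
  Num.max 1 (r ^+ p) * (r ^+ n * w x) * N x by ring.
rewrite ler_wpM2r ?seminorm_ge0 // ler_wpM2l ?(ltW (max_gt0 r)) //.
exact: set_pow_growth (ltW r0) wA _ _ _ AP.
Qed.

(** The constant in [growth_gt] depends continuously on r, so the bound survives
at r = rho A. *)
Lemma growth_jsr n P x : set_pow A n P ->
  N (P *m x) <= kappa (rho A) * rho A ^+ n * N x.
Proof.
move=> AP.
have := @le_right_limit_max_exprn R 0 ('X^n * (N x)%:P) p (rho A) (c * N (P *m x)).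
rewrite horner0 add0r hornerM hornerXn hornerC mulrA => hl.
rewrite -(ler_pM2l c0) (le_trans (hl _)) // => [r rr|].
  by rewrite horner0 add0r hornerM hornerXn hornerC mulrA growth_gt.
have -> : c * (kappa (rho A) * rho A ^+ n * N x)
    = Num.max 1 (rho A ^+ p) * rho A ^+ n * N x.
  by field; rewrite gt_eqF.
by [].
Qed.

(** Measured by an extremal norm of A, a matrix of B is at most r plus the
eccentricity times its distance to A. *)
Lemma jsr_upper : 0 <= h ->
  (forall P, B P -> exists2 M, A M & forall x, N ((P - M) *m x) <= h * N x) ->
  rho B <= rho A + kappa (rho A) * h.
Proof.
move=> h0 hBA; have := @le_right_limit_max_exprn R 'X (h / c)%:P p (rho A) (rho B).
rewrite hornerX hornerC => hl; rewrite mulrAC -mulrA; apply: hl => r rr.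
rewrite hornerX hornerC.
have [C C0 hC] := jsr_lt hN d0 A0 D0 AD rr.
have r0 : 0 < r by apply: le_lt_trans rr; exact: (jsr_ge0 hN d0 A0 D0 AD).
have hw := tail_sup_seminorm hN A0 r0 hC 0; set w := tail_sup N A r 0 in hw.
have wA M z : A M -> w (M *m z) <= r * w z by exact: (tail_sup_mulmx_le A0 r0 hC).
have s0 : 0 <= r + Num.max 1 (r ^+ p) * (h / c).
  by rewrite addr_ge0 ?(ltW r0) // mulr_ge0 ?(ltW (max_gt0 r)) // divr_ge0 // ltW.
have wB P x : B P -> w (P *m x) <= (r + Num.max 1 (r ^+ p) * (h / c)) * w x.
  have [-> _|/eqP x0 BP] := eqVneq x 0.
    by rewrite mulmx0 (seminorm0 hw) mulr0.
  have [M AM /(_ x) PM] := hBA _ BP.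
  rewrite -[P](subrK M) mulmxDl addrC (le_trans (seminormD hw _ _)) //.
  rewrite mulrDl lerD ?wA //.
  rewrite [_ * (h / c)]mulrA [_ * h / c]mulrAC.
  exact: (dominates_eccentricity hw (ltW r0) wA x0 PM).
apply: (jsr_le hN d0 B0 E0 BE s0 C0) => n P x BP.
have Nw : N (P *m x) <= w (P *m x).
  have := le_tail_sup r0 hC (P *m x) (leqnn 0) (erefl : set_pow A 0 1%:M).
  by rewrite mul1mx expr0 divr1.
rewrite (le_trans Nw) // (le_trans (set_pow_growth s0 wB x BP)) //.
rewrite mulrAC mulrC ler_wpM2r ?exprn_ge0 //.
exact: (tail_sup_bounded A0 r0 hC).
Qed.

(** Descending the levels of [tail_sup]: each matrix of A that nearly attains
v_(m+1) is replaced by a near matrix of B.  The error is measured by v_m but has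
to be absorbed by v_(m+1); since v_m <= (1 + e) * L * N for m >= m0 and L * N is
at most k * v_(m+1), the level shift costs only the factor 1 + e. *)
Lemma jsr_lower_of_growth (r e : R) : 0 < r -> 0 <= h -> 0 < e ->
  (forall n P x, set_pow A n P -> N (P *m x) <= kappa r * r ^+ n * N x) ->
  (forall l m, l < 1 -> (0 < m)%N ->
    ~ (forall P x, set_pow A m P -> N (P *m x) <= l * r ^+ m * N x)) ->
  (forall M, A M -> exists2 P, B P & forall x, N ((M - P) *m x) <= h * N x) ->
  r * (1 - e) - (1 + e) * (kappa r * h) <= rho B.
Proof.
move=> r0 h0 e0; set k := kappa r; set lam := _ - _ => hC contraction hAB.
have k0 : 0 < k by rewrite divr_gt0.
have [lam0|lam0] := leP lam 0.
  exact: le_trans lam0 (jsr_ge0 hN d0 B0 E0 BE).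
pose v := tail_sup N A r.
have hv m : is_seminorm (v m) := tail_sup_seminorm hN A0 r0 hC m.
have vA m M x : A M -> v m (M *m x) <= r * v m x by exact: (tail_sup_mulmx_le A0 r0 hC).
pose S := [set l | exists m, forall y, v m y <= l * N y].
(* the products of m.+1 factors, rather than m, since m may be 0 *)
have S1 l : S l -> 1 <= l.
  move=> [m vl]; rewrite leNgt; apply/negP => l1.
  apply: (contraction l m.+1 l1 (ltn0Sn m)) => P x AP.
  have := le_tail_sup r0 hC x (leqnSn m) AP.
  rewrite ler_pdivrMr ?exprn_gt0 // => Px; apply: le_trans Px _.
  rewrite mulrAC; apply: ler_wpM2r; last exact: vl.
  exact/exprn_ge0/ltW.
have Sk : S k by exists 0%N => y; exact: (tail_sup_bounded A0 r0 hC).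
pose L := inf S.
have L1 : 1 <= L by apply: lb_le_inf => //; exists k.
have L0 : 0 < L := lt_le_trans ltr01 L1.
(* by [dominates], v_m is bounded by a multiple of N that any single value of v_m
   determines, and L lies below all such multiples *)
have vL m x : x <> 0 -> L * N x <= k * v m x.
  move=> x0; have Nx := norm_gt0 hN x0.
  rewrite -ler_pdivlMr //; apply: ge_inf; first by exists 1 => l /S1.
  exists m => y; rewrite -(ler_pM2r Nx) -(ler_pM2l c0) mulrA.
  rewrite (le_trans (Ac (hv m) (ltW r0) (vA m) x y)) //.
  have -> : c * (k * v m x / N x * N y * N x) = Num.max 1 (r ^+ p) * v m x * N y.
    by rewrite /k; field; rewrite !gt_eqF.
  by [].
have [l [m0 vl] le] : exists2 l, S l & l < (1 + e) * L.
  have [|l] := @inf_lt _ S ((1 + e) * L) (ex_intro _ k Sk).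
    by rewrite -[ltLHS]mul1r ltr_pM2r // ltrDl.
  by exists l.
have step m x : (m0 <= m)%N -> x <> 0 ->
    exists2 P, B P & lam * v m.+1 x <= v m (P *m x) /\ 0 < v m.+1 x.
  move=> mm x0; have Nx := norm_gt0 hN x0.
  have vx : 0 < v m.+1 x.
    by rewrite -(pmulr_rgt0 _ k0) (lt_le_trans _ (vL _ _ x0)) // mulr_gt0.
  have [M AM] : exists2 M, A M & r * ((1 - e) * v m.+1 x) < v m (M *m x).
    by apply: (tail_sup_attained A0 r0 hC);
      rewrite -/(v m.+1 x) gtr_pMl // gtrDl oppr_lt0.
  have [P BP /(_ x) MP] := hAB _ AM => Mx.
  exists P => //; split=> //.
  have := seminorm_leB (hv m) (P *m x) (M *m x).
  rewrite -mulmxBl -opprB mulNmx (seminormN (hv m)).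
  have : v m ((M - P) *m x) <= (1 + e) * (k * h) * v m.+1 x.
    rewrite (le_trans (tail_sup_antitone A0 r0 hC _ mm)) // (le_trans (vl _)) //.
    have l0 : 0 <= l := le_trans ler01 (S1 _ (ex_intro _ m0 vl)).
    have hNx : 0 <= h * N x by rewrite mulr_ge0 // ltW.
    apply: le_trans (ler_wpM2l l0 MP) _; apply: le_trans (ler_wpM2r hNx (ltW le)) _.
    have -> : (1 + e) * L * (h * N x) = (1 + e) * h * (L * N x) by ring.
    have -> : (1 + e) * (k * h) * v m.+1 x = (1 + e) * h * (k * v m.+1 x) by ring.
    by rewrite ler_wpM2l ?vL // mulr_ge0 // addr_ge0 // ltW.
  rewrite /lam mulrBl; move: Mx; rewrite mulrA; lra.
have chain n m x : (m0 <= m)%N -> x <> 0 ->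
    exists2 P, set_pow B n P & lam ^+ n * v (m + n)%N x <= v m (P *m x).
  elim: n m x => [|n IH] m x mm x0.
    by exists 1%:M; rewrite // expr0 mul1r addn0 mul1mx.
  have [Q BQ [Qx vx]] := step (m + n)%N x (leq_trans mm (leq_addr _ _)) x0.
  have Qx0 : Q *m x <> 0.
    move=> Qx0; move: Qx; rewrite Qx0 (seminorm0 (hv _)) leNgt => /negP[].
    by rewrite mulr_gt0.
  have [P BP Px] := IH m (Q *m x) mm Qx0.
  exists (P *m Q); first exact: set_pow_mulr.
  rewrite -mulmxA (le_trans _ Px) // exprSr -mulrA ler_wpM2l ?exprn_ge0 ?(ltW lam0) //.
  by rewrite addnS.
have [x x1] := exists_unit_vector hN d0.
have x0 : x <> 0.
  by move=> x0; move: x1; rewrite x0 (seminorm0 hNs) => /esym/eqP; rewrite oner_eq0.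
apply: (jsr_ge hN d0 B0 E0 BE (ltW lam0) (c := L / k / k)) => [|n].
  by rewrite !divr_gt0.
have [P BP Px] := chain n m0 x (leqnn _) x0.
exists P, x; split=> //; first by rewrite x1.
rewrite -(ler_pM2l k0) (le_trans _ (tail_sup_bounded A0 r0 hC m0 _)) //.
rewrite (le_trans _ Px) //.
have -> : k * (L / k / k * lam ^+ n * N x) = lam ^+ n * (L * N x / k).
  by field; rewrite gt_eqF.
by rewrite ler_wpM2l ?exprn_ge0 ?(ltW lam0) // ler_pdivrMr // [leRHS]mulrC vL.
Qed.

(** For rho A = 0 the left-hand side is at most 0. *)
Lemma jsr_lower_eps e : 0 <= h -> 0 < e ->
  (forall M, A M -> exists2 P, B P & forall x, N ((M - P) *m x) <= h * N x) ->
  rho A * (1 - e) - (1 + e) * (kappa (rho A) * h) <= rho B.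
Proof.
move=> h0 e0 hAB; have rA0 := jsr_ge0 hN d0 A0 D0 AD.
have [r0|r0] := eqVneq (rho A) 0.
  rewrite {1}r0 mul0r sub0r (le_trans _ (jsr_ge0 hN d0 B0 E0 BE)) // oppr_le0.
  apply: mulr_ge0; first by rewrite addr_ge0 // ltW.
  by rewrite mulr_ge0 // divr_ge0 // ltW.
have rA : 0 < rho A by rewrite lt_neqAle eq_sym r0.
apply: jsr_lower_of_growth => //; first exact: growth_jsr.
by move=> l m; exact: (jsr_no_contraction hN d0 A0 D0 AD rA).
Qed.

End LipschitzBounds.

(** Both one-sided bounds hold with every h > H in place of the Hausdorff distance
H, which need not be attained; the two estimates are closed by letting h tend to
H, and for the lower one the slack e tends to 0 together with h - H. *)
Lemma jsr_lipschitz (R : realType) (F : base_field) (d : nat)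
  (N : 'cV[scalars R F]_d -> R) (A B : set 'M[scalars R F]_d) (p : nat) (c D E : R) :
  is_norm N -> (0 < d)%N ->
  A !=set0 -> 0 <= D -> opbound N A D -> B !=set0 -> 0 <= E -> opbound N B E ->
  0 < c -> dominates N A p c ->
  `|joint_spectral_radius N A - joint_spectral_radius N B|
    <= Num.max 1 (set_norm N A ^+ p) / c * hausdorff_distance N A B.
Proof.
move=> hN d0 A0 D0 AD B0 E0 BE c0 Ac.
set rA := joint_spectral_radius N A; set rB := joint_spectral_radius N B.
set H := hausdorff_distance N A B.
have H0 : 0 <= H := hausdorff_distance_ge0 hN d0 A0 B0 AD BE.
have rA0 : 0 <= rA := jsr_ge0 hN d0 A0 D0 AD.
pose k := Num.max 1 (rA ^+ p) / c.
have k0 : 0 < k by rewrite divr_gt0 // lt_max ltr01.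
apply: (@le_trans _ _ (k * H)); last first.
  rewrite ler_wpM2r // ler_pM2r ?invr_gt0 // ge_max !le_max lexx /=.
  rewrite lerXn2r ?orbT // ?nnegrE //; last exact: (jsr_le_set_norm hN d0 A0 D0 AD).
  exact: (set_norm_ge0 hN d0 A0 AD).
have HAB e : 0 < e -> hausdorff_distance N A B < H + e by rewrite ltrDl.
have HBA e : 0 < e -> hausdorff_distance N B A < H + e.
  by rewrite (hausdorff_distanceC hN); exact: HAB.
have upper : rB <= rA + k * H.
  apply/ler_addgt0Pr => e e0; have ek : 0 < e / k by rewrite divr_gt0.
  have := jsr_upper hN d0 A0 D0 AD B0 E0 BE c0 Ac (h := H + e / k).
  have -> : rA + k * H + e = rA + k * (H + e / k) by field; rewrite gt_eqF.
  apply; first by rewrite addr_ge0 // ltW.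
  exact: (hausdorff_distance_lt hN d0 A0 BE AD (HBA _ ek)).
have lower : rA - k * H <= rB.
  rewrite -lerN2 opprB.
  pose q : {poly R} := (1 + 'X) * (k%:P * (H%:P + 'X)) - rA%:P * (1 - 'X).
  have qE e : q.[e] = (1 + e) * (k * (H + e)) - rA * (1 - e).
    by rewrite !(hornerD, hornerN, hornerM, hornerC, hornerX).
  have := @le_right_limit_max_exprn R q 0 0 0 (- rB).
  rewrite qE horner0 !mulr0 !addr0 subr0 mul1r mulr1; apply=> e e0.
  rewrite qE horner0 mulr0 addr0 lerNl opprB.
  apply: (jsr_lower_eps hN d0 A0 D0 AD B0 E0 BE c0 Ac) => //.
    by rewrite addr_ge0 // ltW.
  exact: (hausdorff_distance_lt hN d0 B0 AD BE (HAB _ e0)).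
rewrite ler_norml; apply/andP; split; lra.
Qed.

Theorem theorem1 (R : realType) (F : base_field) (d : nat) (hd : (1 <= d)%N)
  (N : 'cV[scalars R F]_d -> R) (hN : is_norm N)
  (A B : set 'M[scalars R F]_d)
  (hA0 : A !=set0) (hA : compact A) (hAirr : irreducible_set A)
  (hB0 : B !=set0) (hB : bounded_set B)
  (p : nat) (hp : (d - 1 <= p)%N) :
  [/\ F = RealScalars -> 0 < irreducibility_measure N p A,
      0 < irreducibility_measure N p A ->
        `|joint_spectral_radius N A - joint_spectral_radius N B|
          <= lipschitz_const N p A * hausdorff_distance N A B,
      0 < circled_irreducibility_measure N p A &
      `|joint_spectral_radius N A - joint_spectral_radius N B|
        <= circled_lipschitz_const N p A * hausdorff_distance N A B].
Proof.
have [D D0 AD] := compact_opbound hN hA.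
have [E E0 BE] := bounded_opbound hN hB.
have circled0 : 0 < circled_irreducibility_measure N p A.
  by apply: (circled_measure_gt0 hN hd hp hAirr); exists D.
split=> //.
- move=> FR; move: N hN A hA0 hA hAirr B hB0 hB AD BE circled0.
  by rewrite FR => *; rewrite irreducibility_measure_real.
- move=> c0; apply: (jsr_lipschitz hN hd hA0 D0 AD hB0 E0 BE c0).
  exact: (inner_radius_dominates hN
    (S := fun x => orbit_upto A p x `|` orbit_upto A p (- x))
    (orbit_upto_circled (A := A) (p := p)) c0).
- apply: (jsr_lipschitz hN hd hA0 D0 AD hB0 E0 BE circled0).
  exact: (inner_radius_dominates hN (S := circled_orbit A p)
    (fun x => @subset_refl _ _) circled0).
Qed.
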